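(* Let $G$ be a connected, regular, simple undirected graph with vertex set $[n]$, $n\geq 6$, let $\sigma_W>0$, and let $\lambda\in[0,1]$. Let $\mathbf{W}\sim\mathcal{N}(\mathbf{0},\sigma_W^2\mathbf{I}_n)$ and let $\mathbf{R}=\mathrm{REM}_G(\lambda,\mathbf{W})$ be the transition rate matrix with $R_{ij}=\exp(\lambda W_i-(1-\lambda)W_j)$ for $(i,j)\in E(G)$ and $R_{ij}=0$ for distinct non-adjacent $i,j$. Then the correlation $\rho=\rho(\mathbf{R})$ satisfies \[ \mathbb{E}(\rho)\geq 1-16\left(1+O(n^{-1/2})\right)(1-\lambda)^2, \] where $O(n^{-1/2})$ denotes a quantity bounded in absolute value by $Cn^{-1/2}$ for an absolute constant $C$ (not depending on $G$, $\sigma_W$ or $\lambda$).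
   Context: For a continuous-time Markov chain with rate matrix $\mathbf{R}$ on $[n]$, the exit rates are $q_i=\sum_{j:\,j\sim i}R_{ij}$ (with $j\sim i$ meaning $(i,j)\in E(G)$), and $\boldsymbol{\pi}$ is its stationary distribution. The correlation is $\rho(\mathbf{R})=\mathrm{Corr}(-\log\pi_I,\log q_I)$ where $I$ is uniform on $[n]$ and the correlation is over $I$ only with $\mathbf{R}$ fixed; $\mathbb{E}$ is over $\mathbf{W}$. *)

(* Defs.v *)
From HB Require Import structures.
From Stdlib Require Import ClassicalEpsilon.
From mathcomp Require Import all_boot all_order all_algebra.
From mathcomp Require Import all_classical all_reals all_analysis.
Set Implicit Arguments. Unset Strict Implicit. Unset Printing Implicit Defensive.
Import Order.TTheory GRing.Theory Num.Theory.
Local Open Scope ring_scope.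

Section REM.
Context {R : realType}.

Definition simple_graph n (G : rel 'I_n) : Prop := symmetric G /\ irreflexive G.
Definition graph_connected n (G : rel 'I_n) : Prop := forall i j, connect G i j.
Definition graph_regular n (G : rel 'I_n) : Prop :=
  exists d : nat, forall i : 'I_n, #|[set j | G i j]| = d.

Definition REM n (G : rel 'I_n) (lam : R) (W : 'I_n -> R) (i j : 'I_n) : R :=
  if G i j then expR (lam * W i - (1 - lam) * W j) else 0.

Definition exit_rate n (G : rel 'I_n) (Q : 'I_n -> 'I_n -> R) (i : 'I_n) : R :=
  \sum_(j | G i j) Q i j.

(* pi is a stationary distribution of the CTMC with rates Q (off-diagonal):
   a probability vector with pi Qgen = 0, i.e. global balance. *)
Definition is_stationary n (G : rel 'I_n) (Q : 'I_n -> 'I_n -> R) (p : 'I_n -> R) : Prop :=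
  (forall i, 0 <= p i) /\ \sum_i p i = 1 /\
  (forall i, \sum_(j | G j i) p j * Q j i = p i * exit_rate G Q i).

(* The stationary distribution (unique for an irreducible chain). *)
Definition stationary n (G : rel 'I_n) (Q : 'I_n -> 'I_n -> R) : 'I_n -> R :=
  epsilon (inhabits (fun _ : 'I_n => 0 : R)) (is_stationary G Q).

Definition umean n (x : 'I_n -> R) : R := (\sum_i x i) / n%:R.
Definition ucov n (x y : 'I_n -> R) : R :=
  (\sum_i (x i - umean x) * (y i - umean y)) / n%:R.
Definition ucorr n (x y : 'I_n -> R) : R :=
  ucov x y / Num.sqrt (ucov x x * ucov y y).

Definition rho n (G : rel 'I_n) (Q : 'I_n -> 'I_n -> R) : R :=
  ucorr (fun i => - ln (stationary G Q i)) (fun i => ln (exit_rate G Q i)).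

(* Expectation over W ~ N(0, s^2 I_n): iterated integral of the coordinates
   0..n-1, each against the normal law N(0, s^2). *)
Fixpoint gauss_iter (s : R) (k : nat) (g : (nat -> R) -> \bar R) : (nat -> R) -> \bar R :=
  match k with
  | 0 => g
  | k'.+1 => gauss_iter s k'
      (fun w => (\int[normal_prob 0 s]_x g (fun j => if j == k' then x else w j))%E)
  end.

Definition gauss_expect n (s : R) (f : ('I_n -> R) -> R) : \bar R :=
  gauss_iter s n (fun w => (f (fun i : 'I_n => w (nat_of_ord i)))%:E) (fun _ => 0).

End REM.

(* Main.v *)
Require Import Defs.
From HB Require Import structures.
From mathcomp Require Import all_boot all_order all_algebra.
From mathcomp Require Import all_classical all_reals all_analysis.
From mathcomp Require Import measurable_realfun ring lra.
Set Implicit Arguments.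
Unset Strict Implicit.
Unset Printing Implicit Defensive.
Import Order.TTheory GRing.Theory Num.Theory.
Import numFieldNormedType.Exports.
Local Open Scope ring_scope.

(** Detailed balance gives [- ln pi_i = W_i + const], while
    [ln q_i = lam W_i + L_i] with [L_i] the log-sum-exp of [- (1 - lam) W_j] over
    the neighbours [j] of [i].  Elementary geometry bounds [1 - rho] by
    [2 Var L / (lam^2 Var W)], and [Var L <= n (1 - lam)^2 Var W] always holds, so
    that the event [Var W < 4/5 sW^2], of exponentially small probability, is
    harmless.  On its complement it remains to bound [E (L_i - L_k)^2] by
    [5.124 (1 - lam)^2 sW^2] uniformly in the degree: since the neighbourhoods of
    [i] and [k] have the same size, one can pair the coordinates they do not share
    and rotate every pair by a quarter turn in many small steps.  The Gaussian law
    is invariant under each rotation, and convexity of the log-sum-exp bounds one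
    step by its directional derivatives, whose second moments are explicit because
    the softmax weights at one end do not involve the coordinates being rotated in.
    This gives the constant [2 (pi/2)^2 < 5.124].  When [(1 - lam)^2 >= 1/8] the
    claim is implied by [rho >= -1]; otherwise [2 / lam^2 < 4.88], and
    [4.88 * (5.124 / 2) / (4/5) < 16]. *)

(** * The Gaussian law on the line *)

(** The whole error must carry the factor [(1 - lam)^2]. On the event of small [Var W] the trivial
    bound [rho >= -1] would therefore be useless as [lam] tends to 1. The deterministic bound on
    [Var L] does carry the factor, and its loss of [n] is absorbed by the exponential decay of the
    probability; the resulting error is far below [n^(-1/2)]. The degree may be bounded or
    comparable to [n], so no concentration of the individual [L_i] is at hand. The rotation replaces
    it by an estimate free of the dimension: it interpolates between [L_i] and [L_k] while keeping
    the law of every intermediate point. Finitely many steps avoid differentiating under the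
    integral. The price is a factor 2, because each step is bounded by the squares of the
    derivatives at both of its ends; the constant 16 leaves room for it. Integrands are kept
    nonnegative, so that Tonelli's theorem suffices; this is why [1 - rho] is integrated and not
    [rho]. *)

Section measurable_real_operations.
Context {d : measure_display} {T : measurableType d} {R : realType}.
Implicit Types f : T -> R.

Lemma measurable_fun_expR f : measurable_fun setT f ->
  measurable_fun setT (fun x => expR (f x)).
Proof. by move=> mf; exact: (measurableT_comp (@measurable_expR R)). Qed.

Lemma measurable_fun_ln f : measurable_fun setT f ->
  measurable_fun setT (fun x => ln (f x)).
Proof. by move=> mf; exact: (measurableT_comp (@measurable_ln R)). Qed.

Lemma measurable_fun_inv f : measurable_fun setT f ->
  measurable_fun setT (fun x => (f x)^-1).
Proof.
move=> mf.
(* [1 / f = f / f^2], with the division expressed by [expR] and [ln], whose measurability is known;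
   at a zero of [f] both sides are 0 by convention. *)
have -> : (fun x => (f x)^-1) = (fun x => f x * expR (- ln (f x ^+ 2))).
  apply/funext => x; have [->|f0] := eqVneq (f x) 0; first by rewrite invr0 mul0r.
  rewrite expRN lnK ?posrE ?exprn_even_gt0//.
  by rewrite expr2 invfM mulrA divff// mul1r.
apply: measurable_funM => //; apply: measurable_fun_expR.
by apply: measurable_funN; apply: measurable_fun_ln; exact: measurable_funX.
Qed.

Lemma measurable_fun_sqrt f : measurable_fun setT f ->
  measurable_fun setT (fun x => Num.sqrt (f x)).
Proof.
move=> mf.
(* [Num.sqrt] vanishes on negative numbers, so truncating at 0 first changes nothing. *)
have -> : (fun x => Num.sqrt (f x)) = (fun x => Num.max (f x) 0 `^ 2^-1).
  apply/funext => x; rewrite powR12_sqrt ?le_max ?lexx ?orbT//.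
  by case: (leP (f x) 0) => // f0; rewrite sqrtr0 ler0_sqrtr.
apply: (measurableT_comp (@measurable_powR R _)).
exact: measurable_maxr.
Qed.

End measurable_real_operations.

Section gaussian_line.
Context {R : realType}.
Local Open Scope classical_set_scope.
Notation mu := (@lebesgue_measure R).
Implicit Types (f : R -> \bar R) (a b c s t x y : R).

Definition translation a : measurableTypeR R -> measurableTypeR R := fun x => x + a.

Let measurable_translation a : measurable_fun setT (translation a).
Proof. exact: measurable_funD. Qed.

HB.instance Definition _ a :=
  isMeasurableFun.Build _ _ _ _ (translation a) (@measurable_translation a).

Lemma lebesgue_measureD a (A : set R) : measurable A ->
  pushforward mu (translation a) A = mu A.
Proof.
move=> mA; apply/esym/lebesgue_measure_unique => //= _ [[u v]] _ <-.
rewrite /pushforward/=.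
have -> : translation a @^-1` `]u, v] = `]u - a, v - a].
  by apply/seteqP; split => x; rewrite /= !in_itv/= ltrBlDr lerBrDr.
rewrite !lebesgue_measure_itv/= !lte_fin ltrD2r; case: ifP => // _.
by rewrite -!EFinB; congr EFin; ring.
Qed.

Lemma ge0_integral_translation f a : measurable_fun setT f ->
  (forall x, 0 <= f x)%E ->
  (\int[mu]_x f (x + a)%R = \int[mu]_x f x)%E.
Proof.
move=> mf f0.
transitivity (\int[pushforward mu (translation a)]_x f x)%E.
  by rewrite ge0_integral_pushforward.
by apply: eq_measure_integral => A mA _; exact: lebesgue_measureD.
Qed.

Lemma ge0_integral_opp f : measurable_fun setT f ->
  (forall x, 0 <= f x)%E ->
  (\int[mu]_x f (- x)%R = \int[mu]_x f x)%E.
Proof.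
move=> mf f0.
transitivity (\int[pushforward mu (-%R : measurableTypeR R -> measurableTypeR R)]_x f x)%E.
  by rewrite ge0_integral_pushforward.
by apply: eq_measure_integral => A mA _; exact: lebesgue_measureN.
Qed.

(** The Radon-Nikodym derivative of [normal_prob] and [normal_pdf] have the same integral over every
    measurable set, hence agree almost everywhere. *)
Lemma ge0_integral_normal_prob m s f : measurable_fun setT f ->
  (forall x, 0 <= f x)%E ->
  (\int[normal_prob m s]_x f x = \int[mu]_x (f x * (normal_pdf m s x)%:E))%E.
Proof.
move=> mf f0.
have dom := @normal_prob_dominates R m s.
rewrite -(Radon_Nikodym_SigmaFinite.change_of_variables dom)//.
have mpdf : measurable_fun setT (EFin \o normal_pdf m s).
  by apply/measurable_EFinP; exact: measurable_normal_pdf.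
have iF := Radon_Nikodym_SigmaFinite.f_integrable dom.
apply: ae_eq_integral => //.
- by apply: emeasurable_funM => //; exact: measurable_int iF.
- exact: emeasurable_funM.
- apply: ae_eqe_mul2l; apply: integral_ae_eq => //.
  by move=> A _ mA; rewrite -Radon_Nikodym_SigmaFinite.f_integral.
Qed.

Lemma normal_pdf0E s x : s != 0 ->
  normal_pdf 0 s x = normal_peak s * expR (- x ^+ 2 / (s ^+ 2 *+ 2)).
Proof. by move=> s0; rewrite normal_pdfE// /normal_fun subr0. Qed.

Lemma ge0_integral_normal_opp s f : measurable_fun setT f ->
  (forall x, 0 <= f x)%E -> s != 0 ->
  (\int[normal_prob 0 s]_x f (- x)%R = \int[normal_prob 0 s]_x f x)%E.
Proof.
move=> mf f0 s0.
have mpdf : measurable_fun setT (EFin \o normal_pdf 0 s).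
  by apply/measurable_EFinP; exact: measurable_normal_pdf.
rewrite !ge0_integral_normal_prob//; last exact: measurableT_comp.
transitivity (\int[mu]_x (fun y => f y * (normal_pdf 0 s y)%:E) (- x)%R)%E.
  by apply: eq_integral => x _; rewrite /= !normal_pdf0E// sqrrN.
apply: ge0_integral_opp; first exact: emeasurable_funM.
by move=> x; rewrite mule_ge0// lee_fin normal_pdf_ge0.
Qed.

(** Completing the square: the tilted density is a constant times the normal density with mean
    [t * s ^+ 2]. *)
Lemma normal_mgf s t : s != 0 ->
  (\int[normal_prob 0 s]_x (expR (t * x))%:E = (expR (t ^+ 2 * s ^+ 2 / 2))%:E)%E.
Proof.
move=> s0; rewrite ge0_integral_normal_prob; last 2 first.
- apply/measurable_EFinP; apply: measurable_fun_expR.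
  exact: measurable_funM.
- by move=> x; rewrite lee_fin expR_ge0.
transitivity (\int[mu]_x ((expR (t ^+ 2 * s ^+ 2 / 2))%:E *
   (normal_pdf (t * s ^+ 2) s x)%:E))%E.
  apply: eq_integral => x _; rewrite -!EFinM; congr EFin.
  rewrite normal_pdf0E// normal_pdfE// /normal_fun.
  rewrite [LHS]mulrCA [RHS]mulrCA; congr (_ * _); rewrite -!expRD.
  by congr expR; field.
rewrite ge0_integralZl//=; first by rewrite integral_normal_pdf mule1.
- by apply/measurable_EFinP; exact: measurable_normal_pdf.
- by move=> x _; rewrite lee_fin normal_pdf_ge0.
Qed.

(** The tilted density is again centred Gaussian, with standard deviation [s / u] for
    [u = Num.sqrt (1 + 2 * t)]; the value is the ratio of the two peaks. *)
Lemma normal_expN_sqr s t : 0 < s -> 0 <= t ->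
  (\int[normal_prob 0 s]_x (expR (- (t * (x ^+ 2 / s ^+ 2))))%:E
   = ((Num.sqrt (1 + 2 * t))^-1)%:E)%E.
Proof.
move=> s0 t0; have sn0 : s != 0 by rewrite gt_eqF.
rewrite ge0_integral_normal_prob; last 2 first.
- apply/measurable_EFinP; apply: measurable_fun_expR.
  apply: measurable_funN; apply: measurable_funM => //.
  by apply: measurable_funM => //; exact: measurable_funX.
- by move=> x; rewrite lee_fin expR_ge0.
set u := Num.sqrt (1 + 2 * t).
have u2 : u ^+ 2 = 1 + 2 * t by rewrite sqr_sqrtr//; lra.
have u0 : 0 < u by rewrite sqrtr_gt0; lra.
have su0 : s / u != 0 by rewrite mulf_neq0// invr_neq0// gt_eqF.
transitivity (\int[mu]_x ((u^-1)%:E * (normal_pdf 0 (s / u) x)%:E))%E.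
  apply: eq_integral => x _; rewrite -!EFinM; congr EFin.
  have pk : normal_peak (s / u) = u * normal_peak s.
    rewrite /normal_peak (_ : _ *+ 2 = u^-1 ^+ 2 * (s ^+ 2 * pi *+ 2)); last by ring.
    rewrite sqrtrM ?sqr_ge0// sqrtr_sqr ger0_norm ?invr_ge0 ?ltW//.
    by rewrite invfM invrK.
  rewrite !normal_pdf0E// mulrCA -expRD pk -[X in _ = _ * X]mulrA [RHS]mulKf ?gt_eqF//.
  congr (_ * expR _).
  rewrite exprMn exprVn u2; field.
  by rewrite sn0/= gt_eqF//; lra.
rewrite ge0_integralZl//=; first by rewrite integral_normal_pdf mule1.
- by apply/measurable_EFinP; exact: measurable_normal_pdf.
- by move=> x _; rewrite lee_fin normal_pdf_ge0.
- by rewrite lee_fin invr_ge0 ltW.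
Qed.

(** The mean value theorem, in the form that integrates an inequality; iterating it gives the Taylor
    bounds for sine and cosine. *)
Lemma ge0_of_derive_ge0 (f df : R -> R) :
  (forall x, is_derive x (1 : R) f (df x)) -> 0 <= f 0 ->
  (forall x, 0 <= x -> 0 <= df x) -> forall x, 0 <= x -> 0 <= f x.
Proof.
move=> fd f0 df0 x; rewrite le_eqVlt => /predU1P[<-//|x0].
have cf : {within `[0, x], continuous f}.
  apply: continuous_subspaceT => y; apply: differentiable_continuous.
  by apply/derivable1_diffP; have [] := fd y.
have [y /[!in_itv]/= /andP[y0 _] e] := MVT x0 (fun y _ => fd y) cf.
by move: e; rewrite subr0 => /eqP; rewrite subr_eq => /eqP ->;
  rewrite addr_ge0// mulr_ge0// ?df0 ?ltW.
Qed.

Lemma expR_sub_expRN_ge x : 0 <= x -> 2 * x <= expR x - expR (- x).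
Proof.
move=> x0; rewrite -subr_ge0; move: x x0.
apply: (@ge0_of_derive_ge0 _ (fun x => expR x + expR (- x) - 2)).
- by move=> x; apply: is_derive_eq; rewrite /GRing.scale/=; ring.
- by rewrite oppr0 expR0; lra.
- move=> x _; rewrite expRN.
  have e0 := expR_gt0 x; have : 0 <= (expR x - 1) ^+ 2 / expR x.
    by rewrite divr_ge0// ?sqr_ge0// ltW.
  have -> // : (expR x - 1) ^+ 2 / expR x = expR x + (expR x)^-1 - 2.
  by field; rewrite gt_eqF.
Qed.

(** The excess of the right side over 2 is [(expR (x / 2) - expR (- (x / 2))) ^+ 2], whose base is
    at least [x] when [x >= 0]. *)
Lemma expR_add_expRN_ge x : 2 + x ^+ 2 <= expR x + expR (- x).
Proof.
wlog x0 : x / 0 <= x => [H|].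
  have [/H//|/ltW x0] := leP 0 x.
  by have := H (- x); rewrite oppr_ge0 sqrrN opprK [expR (- x) + _]addrC; exact.
have h0 : 0 <= x / 2 by lra.
have := expR_sub_expRN_ge h0; rewrite mulrC divfK// => h.
have {h} : x ^+ 2 <= (expR (x / 2) - expR (- (x / 2))) ^+ 2.
  by rewrite ler_sqr ?nnegrE// (le_trans x0).
rewrite sqrrB -!expRM_natl -expRD subrr expR0.
have x2 : 2 * (x / 2) = x by field.
by rewrite mulrN x2; lra.
Qed.

Let measurable_sqr : measurable_fun setT (fun x : measurableTypeR R => (x ^+ 2)%:E).
Proof. by apply/measurable_EFinP; exact: measurable_funX. Qed.

(** Only the upper bound is needed, and it follows from the moment generating function: integrate
    [2 + t^2 x^2 <= expR (t x) + expR (- t x)] and let [t] be small. *)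
Lemma normal_second_moment s : 0 < s ->
  (\int[normal_prob 0 s]_x (x ^+ 2)%:E <= (s ^+ 2)%:E)%E.
Proof.
move=> s0; have sn0 : s != 0 by rewrite gt_eqF.
set m := (X in (X <= _)%E).
have m0 : (0 <= m)%E by apply: integral_ge0 => x _; rewrite lee_fin sqr_ge0.
have mexp u : measurable_fun setT (fun x : measurableTypeR R => (expR (u * x))%:E).
  by apply/measurable_EFinP; apply: measurable_fun_expR; exact: measurable_funM.
have bound u : 0 < u -> (m <= (s ^+ 2 * expR u)%:E)%E.
  (* With this [t] the moment generating function at both [t] and [- t] equals [expR u]. *)
  move=> u0; pose t := Num.sqrt (2 * u) / s.
  have t0 : 0 < t by rewrite divr_gt0// sqrtr_gt0; lra.
  have t2 : t ^+ 2 * s ^+ 2 = 2 * u.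
    by rewrite -exprMn divfK// sqr_sqrtr//; lra.
  have : ((t ^+ 2)%:E * m + 2%:E <= (2 * expR u)%:E)%E.
    have <- : (\int[normal_prob 0 s]_x ((expR (t * x))%:E + (expR (- t * x))%:E)
        = (2 * expR u)%:E)%E.
      rewrite ge0_integralD//; try by move=> x _; rewrite lee_fin expR_ge0.
      rewrite !normal_mgf// sqrrN t2 -EFinD; congr EFin.
      by rewrite [2 * u]mulrC mulfK//; ring.
    have <- : (\int[normal_prob 0 s]_x ((t ^+ 2)%:E * (x ^+ 2)%:E + 2%:E)
        = (t ^+ 2)%:E * m + 2%:E)%E.
      rewrite ge0_integralD//=; last 2 first.
      - by move=> x _; rewrite mule_ge0// lee_fin sqr_ge0.
      - exact: emeasurable_funM.
      rewrite ge0_integralZl//=; last 2 first.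
      - by move=> x _; rewrite lee_fin sqr_ge0.
      - by rewrite lee_fin sqr_ge0.
      by rewrite integral_cst//= probability_setT mule1.
    apply: ge0_le_integral => //.
    - by move=> x _; rewrite adde_ge0 ?mule_ge0 ?lee_fin ?sqr_ge0.
    - by apply: emeasurable_funD => //; exact: emeasurable_funM.
    - exact: emeasurable_funD.
    - move=> x _; rewrite -EFinM -!EFinD lee_fin -exprMn addrC mulNr.
      exact: expR_add_expRN_ge.
  case: (m) m0 => [r||] //.
  - rewrite -EFinM -EFinD !lee_fin => r0 h.
    have e1 : expR u - 1 <= u * expR u.
      have := expR_ge1Dx (- u); rewrite expRN => e1.
      have e2 : (1 + - u) * expR u <= 1.
        by rewrite -ler_pdivlMr ?expR_gt0// div1r.
      lra.
    have h2 : t ^+ 2 * r <= t ^+ 2 * (s ^+ 2 * expR u) by rewrite mulrA t2; lra.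
    by move: h2; rewrite ler_pM2l// exprn_gt0.
  - by move=> _; rewrite gt0_muley ?lte_fin ?exprn_gt0//= leye_eq.
case: (m) m0 bound => [r||] //; last by move=> _ /(_ 1 ltr01).
rewrite !lee_fin => r0 bound; rewrite leNgt; apply/negP => sr.
have s2 : 0 < s ^+ 2 by rewrite exprn_gt0.
have l0 : 0 < ln (r / s ^+ 2) by rewrite ln_gt0// ltr_pdivlMr// mul1r.
(* For this [u], [expR u] is the square root of [r / s ^+ 2 > 1], hence smaller than [r / s ^+ 2],
   against the bound. *)
have := bound (ln (r / s ^+ 2) / 2); rewrite divr_gt0// => /(_ isT).
rewrite lee_fin leNgt => /negP; apply.
rewrite -ltr_pdivlMl// [_^-1 * _]mulrC -[ltRHS]lnK ?posrE ?divr_gt0//.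
  by rewrite ltr_expR; lra.
exact: lt_trans sr.
Qed.

(** Adding the integrals for [b] and [- b], which are equal by symmetry, cancels the cross term
    without ever integrating a signed function. *)
Lemma normal_affine_sqr s a b : 0 < s ->
  (\int[normal_prob 0 s]_x ((a + b * x) ^+ 2)%:E
    <= (a ^+ 2 + b ^+ 2 * s ^+ 2)%:E)%E.
Proof.
move=> s0; have sn0 : s != 0 by rewrite gt_eqF.
have mq c : measurable_fun setT (fun x : measurableTypeR R => ((a + c * x) ^+ 2)%:E).
  apply/measurable_EFinP; apply: measurable_funX; exact: measurable_funD.
set J := (X in (X <= _)%E).
have JN : (\int[normal_prob 0 s]_x ((a + (- b) * x) ^+ 2)%:E = J)%E.
  rewrite /J -(@ge0_integral_normal_opp s (fun x => ((a + b * x) ^+ 2)%:E))//.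
    by apply: eq_integral => x _; rewrite mulNr mulrN.
  - exact: mq.
  - by move=> x; rewrite lee_fin sqr_ge0.
have JJ : (J + J <= (2 * (a ^+ 2 + b ^+ 2 * s ^+ 2))%:E)%E.
  rewrite -{2}JN -ge0_integralD//; try by move=> x _; rewrite lee_fin sqr_ge0.
  have sq x : (((a + b * x) ^+ 2)%:E + ((a + - b * x) ^+ 2)%:E =
      (2 * a ^+ 2)%:E + (2 * b ^+ 2)%:E * (x ^+ 2)%:E)%E.
    by rewrite -EFinM -!EFinD; congr EFin; ring.
  under eq_integral => x _ do rewrite sq.
  have a0 : 0 <= 2 * a ^+ 2 by rewrite mulr_ge0// sqr_ge0.
  have b0 : 0 <= 2 * b ^+ 2 by rewrite mulr_ge0// sqr_ge0.
  rewrite ge0_integralD//=; last 2 first.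
  - by move=> x _; rewrite mule_ge0// lee_fin ?sqr_ge0.
  - exact: emeasurable_funM.
  rewrite integral_cst//= probability_setT mule1.
  rewrite ge0_integralZl//=; last by move=> x _; rewrite lee_fin sqr_ge0.
  rewrite mulrDr EFinD leeD2l// mulrA [(_ * s ^+ 2)%:E]EFinM.
  by rewrite lee_wpmul2l// normal_second_moment.
have J0 : (0 <= J)%E by apply: integral_ge0 => x _; rewrite lee_fin sqr_ge0.
by case: (J) J0 JJ => [r||]//= _; rewrite -?EFinD ?lee_fin => ?; lra.
Qed.

End gaussian_line.

(** * Rotation invariance in the plane *)

Section gaussian_plane.
Context {R : realType}.
Local Open Scope classical_set_scope.
Notation mu := (@lebesgue_measure R).
Notation TR := (measurableTypeR R).
Implicit Types (F g : TR * TR -> \bar R) (a b c s t x y : R).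

Let measurable_shear1 a : measurable_fun setT
  (fun z : TR * TR => (z.1 + a * z.2, z.2) : TR * TR).
Proof.
apply/measurable_fun_pairP; split; last exact: measurable_snd.
apply: measurable_funD; first exact: measurable_fst.
by apply: measurable_funM => //; exact: measurable_snd.
Qed.

Let measurable_shear2 a : measurable_fun setT
  (fun z : TR * TR => (z.1, z.2 + a * z.1) : TR * TR).
Proof.
apply/measurable_fun_pairP; split; first exact: measurable_fst.
apply: measurable_funD; first exact: measurable_snd.
by apply: measurable_funM => //; exact: measurable_fst.
Qed.

Let integral_shear2 F a : measurable_fun setT F -> (forall z, 0 <= F z)%E ->
  (\int[mu]_x \int[mu]_y F (x, y + a * x)%R = \int[mu]_x \int[mu]_y F (x, y))%E.
Proof.
move=> mF F0; apply: eq_integral => x _.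
apply: (ge0_integral_translation (f := fun y => F (x, y))) => //.
exact: (measurableT_comp mF (measurable_pair1 x)).
Qed.

Let integral_shear1 F a : measurable_fun setT F -> (forall z, 0 <= F z)%E ->
  (\int[mu]_x \int[mu]_y F (x + a * y, y)%R = \int[mu]_x \int[mu]_y F (x, y))%E.
Proof.
move=> mF F0.
pose F' (z : TR * TR) := F (z.1 + a * z.2, z.2)%R.
have mF' : measurable_fun setT F'.
  exact: (measurableT_comp mF (measurable_shear1 a)).
have F'0 z : (0 <= F' z)%E by exact: F0.
(* The sheared coordinate is the outer variable: exchange the integrals, translate, exchange
   back. *)
refine (eq_trans (fubini_tonelli F' mF' F'0)
                 (eq_trans _ (esym (fubini_tonelli F mF F0)))).
apply: eq_integral => y _.
refine (@ge0_integral_translation R (fun x => F (x, y)) (a * y) _ _) => //.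
exact: (measurableT_comp mF (measurable_pair2 y)).
Qed.

(* A plane rotation by an angle with nonzero sine is a product of three shears. *)
Lemma lebesgue_rotation F c t : c ^+ 2 + t ^+ 2 = 1 -> t != 0 ->
  measurable_fun setT F -> (forall z, 0 <= F z)%E ->
  (\int[mu]_x \int[mu]_y F (c * x + t * y, c * y - t * x)%R =
   \int[mu]_x \int[mu]_y F (x, y))%E.
Proof.
(* If [c] and [t] are the cosine and sine of [th], then [a] is [tan (th / 2)], and shears by [a],
   [- t], [a] compose to the rotation. *)
move=> ct t0 mF F0; pose a := (1 - c) / t.
pose F1 (z : TR * TR) := F (z.1 + a * z.2, z.2)%R.
have mF1 : measurable_fun setT F1 by exact: (measurableT_comp mF (measurable_shear1 a)).
have F10 z : (0 <= F1 z)%E by exact: F0.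
pose F2 (z : TR * TR) := F1 (z.1, z.2 + (- t) * z.1)%R.
have mF2 : measurable_fun setT F2 by exact: (measurableT_comp mF1 (measurable_shear2 (- t))).
have F20 z : (0 <= F2 z)%E by exact: F0.
refine (eq_trans _ (eq_trans (integral_shear1 a mF2 F20)
  (eq_trans (integral_shear2 (- t) mF1 F10) (integral_shear1 a mF F0)))).
apply: eq_integral => x _; apply: eq_integral => y _; congr F.
have ta : t * a = 1 - c by rewrite /a mulrC divfK.
have aa : a * (1 + c) = t.
  apply: (mulfI t0); rewrite mulrA ta -[RHS]expr2 -[RHS](addKr (c ^+ 2)) ct; ring.
have cE : 1 - t * a = c by rewrite ta; ring.
rewrite /=; congr pair.
  rewrite [RHS](_ : _ = x * (1 - t * a) + y * (a * (1 + (1 - t * a)))); last by ring.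
  by rewrite cE aa; ring.
rewrite [RHS](_ : _ = y * (1 - t * a) - t * x); last by ring.
by rewrite cE; ring.
Qed.

Let measurable_rot c t : measurable_fun setT
  (fun z : TR * TR => (c * z.1 + t * z.2, c * z.2 - t * z.1) : TR * TR).
Proof.
have [m1 m2] := (@measurable_fst _ _ TR TR, @measurable_snd _ _ TR TR).
apply/measurable_fun_pairP; split.
  by apply: measurable_funD; exact: measurable_funM.
by apply: measurable_funB; exact: measurable_funM.
Qed.

(** The joint density depends on [x ^+ 2 + y ^+ 2] only, so the invariance is inherited from
    Lebesgue measure. *)
Lemma normal_rotation s c t g : s != 0 -> c ^+ 2 + t ^+ 2 = 1 -> t != 0 ->
  measurable_fun setT g -> (forall z, 0 <= g z)%E ->
  (\int[normal_prob 0 s]_x \int[normal_prob 0 s]_y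
     g (c * x + t * y, c * y - t * x)%R =
   \int[normal_prob 0 s]_x \int[normal_prob 0 s]_y g (x, y))%E.
Proof.
move=> s0 ct t0 mg g0.
pose phi x := normal_pdf 0 s x.
have phi0 x : 0 <= phi x by exact: normal_pdf_ge0.
have mphi : measurable_fun setT (EFin \o phi).
  by apply/measurable_EFinP; exact: measurable_normal_pdf.
pose H h (z : TR * TR) := (h z * (phi z.2)%:E * (phi z.1)%:E)%E.
have mH h : measurable_fun setT h -> measurable_fun setT (H h).
  move=> mh; apply: emeasurable_funM; last exact: (measurableT_comp mphi measurable_fst).
  apply: emeasurable_funM => //; exact: (measurableT_comp mphi measurable_snd).
have dens h : measurable_fun setT h -> (forall z, 0 <= h z)%E ->
    (\int[normal_prob 0 s]_x \int[normal_prob 0 s]_y h (x, y) =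
     \int[mu]_x \int[mu]_y H h (x, y))%E.
  move=> mh h0; rewrite ge0_integral_normal_prob; last 2 first.
  - exact: (measurable_fun_fubini_tonelli_F (m2 := normal_prob 0 s) h).
  - by move=> x; exact: integral_ge0.
  apply: eq_integral => x _.
  have mhx : measurable_fun setT (fun y => h (x, y)).
    exact: (measurableT_comp mh (measurable_pair1 x)).
  rewrite ge0_integral_normal_prob// -ge0_integralZr//.
  - exact: emeasurable_funM.
  - by move=> y _; rewrite mule_ge0// lee_fin.
  - by rewrite lee_fin.
pose gr z := g (c * z.1 + t * z.2, c * z.2 - t * z.1)%R.
have mgr : measurable_fun setT gr by exact: (measurableT_comp mg (measurable_rot c t)).
have Hg0 z : (0 <= H g z)%E by rewrite !mule_ge0// lee_fin.
refine (eq_trans (dens gr mgr _) (eq_trans _ (eq_trans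
  (lebesgue_rotation ct t0 (mH _ mg) Hg0) (esym (dens g mg g0))))); first by move=> z; exact: g0.
apply: eq_integral => x _; apply: eq_integral => y _.
rewrite /H /gr/= -!muleA -!EFinM; congr (_ * _%:E)%E.
rewrite /phi !normal_pdf0E// mulrACA [RHS]mulrACA -!expRD; congr (_ * expR _).
have c2 : c ^+ 2 = 1 - t ^+ 2 by rewrite -ct; ring.
rewrite -!mulrDl; congr (_ * _).
by rewrite sqrrB sqrrD !exprMn c2; ring.
Qed.

End gaussian_plane.

(** * Iterated Gaussian integrals *)

Section plots.
Context {R : realType}.
Local Notation RN := (nat -> R).

(* The product sigma-algebra on [nat -> R] is only ever probed through maps into
   it whose coordinates are measurable. *)
Definition plot_measurable {d' : measure_display} {Y : measurableType d'}
    (g : RN -> Y) : Prop :=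
  forall (d : measure_display) (X : measurableType d) (phi : X -> RN),
    (forall k, measurable_fun setT (fun x => phi x k)) ->
    measurable_fun setT (fun x => g (phi x)).

Implicit Types (f : RN -> R) (g : RN -> \bar R).

Lemma plot_coord k : plot_measurable (fun w : RN => w k).
Proof. by move=> d X phi; exact. Qed.

Lemma plot_cst (c : R) : plot_measurable (fun _ : RN => c).
Proof. by move=> d X phi _; exact: measurable_cst. Qed.

Lemma plotD f1 f2 : plot_measurable f1 -> plot_measurable f2 ->
  plot_measurable (fun w => f1 w + f2 w).
Proof. by move=> m1 m2 d X phi mphi; apply: measurable_funD; [exact: m1|exact: m2]. Qed.

Lemma plotM f1 f2 : plot_measurable f1 -> plot_measurable f2 ->
  plot_measurable (fun w => f1 w * f2 w).
Proof. by move=> m1 m2 d X phi mphi; apply: measurable_funM; [exact: m1|exact: m2]. Qed.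

Lemma plotN f : plot_measurable f -> plot_measurable (fun w => - f w).
Proof. by move=> mf d X phi mphi; apply: measurable_funN; exact: mf. Qed.

Lemma plotX f n : plot_measurable f -> plot_measurable (fun w => f w ^+ n).
Proof. by move=> mf d X phi mphi; apply: measurable_funX; exact: mf. Qed.

Lemma plot_expR f : plot_measurable f -> plot_measurable (fun w => expR (f w)).
Proof. by move=> mf d X phi mphi; apply: measurable_fun_expR; exact: mf. Qed.

Lemma plot_ln f : plot_measurable f -> plot_measurable (fun w => ln (f w)).
Proof. by move=> mf d X phi mphi; apply: measurable_fun_ln; exact: mf. Qed.

Lemma plotV f : plot_measurable f -> plot_measurable (fun w => (f w)^-1).
Proof. by move=> mf d X phi mphi; apply: measurable_fun_inv; exact: mf. Qed.

Lemma plot_sqrt f : plot_measurable f -> plot_measurable (fun w => Num.sqrt (f w)).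
Proof. by move=> mf d X phi mphi; apply: measurable_fun_sqrt; exact: mf. Qed.

Lemma plot_sum (I : Type) (r : seq I) (P : pred I) (F : I -> RN -> R) :
  (forall i, plot_measurable (F i)) ->
  plot_measurable (fun w => \sum_(i <- r | P i) F i w).
Proof.
move=> mF; elim: r => [|i r IH].
  rewrite (_ : (fun _ => _) = fun=> 0); first exact: plot_cst.
  by apply/funext => w; rewrite big_nil.
rewrite (_ : (fun _ => _) = fun w =>
    (if P i then F i w else 0) + \sum_(i <- r | P i) F i w).
  by apply: plotD => //; case: (P i) => //; exact: plot_cst.
by apply/funext => w; rewrite big_cons; case: ifP => // _; rewrite add0r.
Qed.

Lemma plot_comp {d' : measure_display} {Y : measurableType d'} (g : RN -> Y)
    (r : RN -> RN) :
  plot_measurable g -> (forall k, plot_measurable (fun w => r w k)) ->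
  plot_measurable (fun w => g (r w)).
Proof. by move=> mg mr d X phi mphi; apply: mg => k; exact: mr. Qed.

(** What Tonelli's theorem asks for; inside this class no integrability conditions arise. *)
Definition ge0_plot g := plot_measurable g /\ forall w, (0 <= g w)%E.

Lemma ge0_plot_EFin f : plot_measurable f -> (forall w, 0 <= f w) ->
  ge0_plot (fun w => (f w)%:E).
Proof.
move=> mf f0; split=> [d X phi mphi|w]; last by rewrite lee_fin.
by apply/measurable_EFinP; exact: mf.
Qed.

Lemma ge0_plot_comp g (r : RN -> RN) : ge0_plot g ->
  (forall k, plot_measurable (fun w => r w k)) -> ge0_plot (fun w => g (r w)).
Proof. by move=> [mg g0] mr; split=> //; exact: plot_comp. Qed.

Lemma ge0_plotD g1 g2 : ge0_plot g1 -> ge0_plot g2 ->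
  ge0_plot (fun w => g1 w + g2 w)%E.
Proof.
move=> [m1 p1] [m2 p2]; split=> [d X phi mphi|w]; last by rewrite adde_ge0.
by apply: emeasurable_funD; [exact: m1|exact: m2].
Qed.

End plots.

Section iterated_gaussian.
Context {R : realType} (s : R).
Local Notation RN := (nat -> R).
Implicit Types (f : RN -> R) (g : RN -> \bar R) (w : RN) (l : seq nat).

Definition upd w k x : RN := fun j => if j == k then x else w j.

Definition gint k g : RN -> \bar R :=
  fun w => (\int[normal_prob 0 s]_x g (upd w k x))%E.

(** Listing the coordinates instead of counting them allows them to be permuted, so that any chosen
    ones can be integrated innermost. *)
Definition giter l g : RN -> \bar R := foldr gint g l.

Lemma gauss_iterE n g : gauss_iter s n g = giter (iota 0 n) g.
Proof.
elim: n g => [//|n IH] g.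
have -> : iota 0 n.+1 = rcons (iota 0 n) n by rewrite -addn1 iotaD cats1.
by rewrite /giter foldr_rcons; exact: IH.
Qed.

Lemma giter_cat l1 l2 g : giter (l1 ++ l2) g = giter l1 (giter l2 g).
Proof. exact: foldr_cat. Qed.

Let measurable_upd g w k : plot_measurable g ->
  measurable_fun setT (fun x : measurableTypeR R => g (upd w k x)).
Proof.
move=> mg; apply: (mg _ (measurableTypeR R)) => j; rewrite /upd.
by case: (j == k); [exact: measurable_id|exact: measurable_cst].
Qed.

(** Tonelli on [X * R], where [X] is the test space of the plot; because plots range over all test
    spaces, the product is again admissible. *)
Lemma ge0_plot_gint k g : ge0_plot g -> ge0_plot (gint k g).
Proof.
move=> [mg g0]; split=> [d X phi mphi|w]; last exact: integral_ge0.
pose h (z : X * measurableTypeR R) := g (upd (phi z.1) k z.2).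
have mh : measurable_fun setT h.
  apply: (mg _ (X * measurableTypeR R)%type (fun z => upd (phi z.1) k z.2)) => j.
  rewrite /upd; case: (j == k); first exact: measurable_snd.
  exact: (measurableT_comp (mphi j) measurable_fst).
exact: (@measurable_fun_fubini_tonelli_F _ _ X (measurableTypeR R) R
  (normal_prob 0 s) h mh (fun z => g0 _)).
Qed.

Lemma ge0_plot_giter l g : ge0_plot g -> ge0_plot (giter l g).
Proof. by move=> pg; elim: l => //= k l IH; exact: ge0_plot_gint. Qed.

Lemma gint_le k g1 g2 : ge0_plot g1 -> ge0_plot g2 ->
  (forall w, g1 w <= g2 w)%E -> forall w, (gint k g1 w <= gint k g2 w)%E.
Proof.
move=> [m1 p1] [m2 p2] le12 w.
by apply: ge0_le_integral => //; exact: measurable_upd.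
Qed.

Lemma giter_le l g1 g2 : ge0_plot g1 -> ge0_plot g2 ->
  (forall w, g1 w <= g2 w)%E -> forall w, (giter l g1 w <= giter l g2 w)%E.
Proof.
move=> p1 p2 le12; elim: l => //= k l IH.
by apply: gint_le => //; exact: ge0_plot_giter.
Qed.

Lemma giterD l g1 g2 : ge0_plot g1 -> ge0_plot g2 ->
  giter l (fun w => g1 w + g2 w)%E = (fun w => giter l g1 w + giter l g2 w)%E.
Proof.
move=> p1 p2; elim: l => //= k l ->; apply/funext => w.
have [m1 q1] := ge0_plot_giter l p1; have [m2 q2] := ge0_plot_giter l p2.
by rewrite /gint ge0_integralD//; exact: measurable_upd.
Qed.

Lemma giterZ l (c : R) g : 0 <= c -> ge0_plot g ->
  giter l (fun w => c%:E * g w)%E = (fun w => c%:E * giter l g w)%E.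
Proof.
move=> c0 pg; elim: l => //= k l ->; apply/funext => w.
have [m1 q1] := ge0_plot_giter l pg.
by rewrite /gint ge0_integralZl//; exact: measurable_upd.
Qed.

Lemma gint_cst k (c : \bar R) : gint k (fun=> c) = (fun=> c).
Proof. by apply/funext => w; rewrite /gint integral_cst//= probability_setT mule1. Qed.

Lemma giter_cst l (c : \bar R) : giter l (fun=> c) = (fun=> c).
Proof. by elim: l => //= k l ->; rewrite gint_cst. Qed.

Lemma giter_sum (I : Type) (r : seq I) (F : I -> RN -> R) l w :
  (forall i, plot_measurable (F i)) -> (forall i w, 0 <= F i w) ->
  (giter l (fun w => (\sum_(i <- r) F i w)%:E) w =
   \sum_(i <- r) giter l (fun w => (F i w)%:E) w)%E.
Proof.
move=> mF F0; elim: r => [|i r IH].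
  rewrite big_nil (_ : (fun _ => _) = fun=> 0%E) ?giter_cst//.
  by apply/funext => v; rewrite big_nil.
rewrite big_cons -IH (_ : (fun _ => _) =
    fun v => ((F i v)%:E + (\sum_(i <- r) F i v)%:E)%E); last first.
  by apply/funext => v; rewrite big_cons.
rewrite giterD//; apply: ge0_plot_EFin => //; first exact: plot_sum.
by move=> v; exact: sumr_ge0.
Qed.

Lemma gintC j k g : ge0_plot g -> gint j (gint k g) = gint k (gint j g).
Proof.
move=> [mg g0]; have [->//|jk] := eqVneq j k.
apply/funext => w.
pose h (z : measurableTypeR R * measurableTypeR R) := g (upd (upd w j z.1) k z.2).
have mh : measurable_fun setT h.
  apply: (mg _ (measurableTypeR R * measurableTypeR R)%type
    (fun z => upd (upd w j z.1) k z.2)) => i.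
  rewrite /upd; case: (i == k); first exact: measurable_snd.
  by case: (i == j); [exact: measurable_fst|exact: measurable_cst].
refine (eq_trans (fubini_tonelli (m1 := normal_prob 0 s) (m2 := normal_prob 0 s)
  h mh (fun z => g0 _)) _).
apply: eq_integral => y _; apply: eq_integral => x _; congr g.
apply/funext => i; rewrite /upd/=; case: eqP => [->|//].
by rewrite eq_sym (negbTE jk).
Qed.

Lemma giter_perm l l' g : ge0_plot g -> perm_eq l l' -> giter l g = giter l' g.
Proof.
move=> pg; elim: l l' => [|x l IH] l'; first by rewrite perm_sym => /perm_nilP ->.
move=> pl; have xl' : x \in l' by rewrite -(perm_mem pl) mem_head.
case/splitPr: xl' pl => l1 l2; rewrite perm_sym.
rewrite perm_catC cat_cons perm_cons perm_catC perm_sym => /IH /= ->.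
elim: l1 => //= y l1 <-; rewrite -gintC//.
exact: ge0_plot_giter.
Qed.

Definition pairrot (c t : R) a b w : RN := fun j =>
  if j == a then c * w a + t * w b
  else if j == b then c * w b - t * w a else w j.

Lemma plot_pairrot c t a b k : plot_measurable (fun w => pairrot c t a b w k).
Proof.
rewrite /pairrot; case: (k == a).
  by apply: plotD; (apply: plotM; [exact: plot_cst|exact: plot_coord]).
case: (k == b); last exact: plot_coord.
apply: plotD; last apply: plotN;
  by apply: plotM; [exact: plot_cst|exact: plot_coord].
Qed.

(** Once [a] and [b] are moved to the innermost places, this is invariance in the plane with the
    other coordinates frozen. *)
Lemma giter_pairrot c t a b l g : s != 0 -> c ^+ 2 + t ^+ 2 = 1 -> t != 0 ->
  a != b -> a \in l -> b \in l -> ge0_plot g ->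
  giter l (fun w => g (pairrot c t a b w)) = giter l g.
Proof.
move=> s0 ct t0 ab al bl pg.
pose l' := rem b (rem a l).
have pl : perm_eq l (l' ++ [:: a; b]).
  rewrite (perm_trans (perm_to_rem al))// perm_sym perm_catC/= perm_cons perm_sym.
  apply: perm_to_rem; move: bl; rewrite (perm_mem (perm_to_rem al)) in_cons.
  by rewrite eq_sym (negbTE ab).
have pgr : ge0_plot (fun w => g (pairrot c t a b w)).
  by apply: ge0_plot_comp => // k; exact: plot_pairrot.
rewrite (giter_perm pgr pl) (giter_perm pg pl) !giter_cat; congr giter; apply/funext => w /=.
case: pg => mg g0.
pose h (z : measurableTypeR R * measurableTypeR R) := g (upd (upd w a z.1) b z.2).
have mh : measurable_fun setT h.
  apply: (mg _ (measurableTypeR R * measurableTypeR R)%type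
    (fun z => upd (upd w a z.1) b z.2)) => i.
  rewrite /upd; case: (i == b); first exact: measurable_snd.
  by case: (i == a); [exact: measurable_fst|exact: measurable_cst].
refine (eq_trans _ (normal_rotation s0 ct t0 mh (fun z => g0 _))).
apply: eq_integral => x _; apply: eq_integral => y _; congr g.
apply/funext => i; rewrite /pairrot /upd/= !eqxx (negbTE ab).
case: (eqVneq i a) => [->|ia]; first by rewrite (negbTE ab).
by case: eqP.
Qed.

Definition rots (c t : R) (ps : seq (nat * nat)) w : RN :=
  foldr (fun p v => pairrot c t p.1 p.2 v) w ps.

Lemma plot_rots c t ps k : plot_measurable (fun w => rots c t ps w k).
Proof.
elim: ps k => [|p ps IH] k /=; first exact: plot_coord.
exact: (plot_comp (plot_pairrot c t p.1 p.2 k)).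
Qed.

Lemma giter_rots c t ps l g : s != 0 -> c ^+ 2 + t ^+ 2 = 1 -> t != 0 ->
  (forall p, p \in ps -> [/\ p.1 != p.2, p.1 \in l & p.2 \in l]) ->
  ge0_plot g -> giter l (fun w => g (rots c t ps w)) = giter l g.
Proof.
move=> s0 ct t0; elim: ps g => [//|p ps IH] g psl pg /=.
have [pp p1 p2] := psl p (mem_head _ _).
rewrite (IH (fun w => g (pairrot c t p.1 p.2 w))).
- exact: giter_pairrot.
- by move=> q qps; apply: psl; rewrite in_cons qps orbT.
- by apply: ge0_plot_comp => // k; exact: plot_pairrot.
Qed.

End iterated_gaussian.

Section rotation_values.
Context {R : realType}.
Implicit Types (w : nat -> R) (ps : seq (nat * nat)) (c t : R).

Lemma rots_out c t ps w j : j \notin unzip1 ps -> j \notin unzip2 ps ->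
  rots c t ps w j = w j.
Proof.
elim: ps => //= p ps IH; rewrite !in_cons !negb_or => /andP[j1 h1] /andP[j2 h2].
by rewrite /pairrot (negbTE j1) (negbTE j2) IH.
Qed.

(** No index occurs twice, so each coordinate is touched by a single rotation and the order of [ps]
    is immaterial. *)
Lemma rots_pair c t ps w p : uniq (unzip1 ps ++ unzip2 ps) -> p \in ps ->
  rots c t ps w p.1 = c * w p.1 + t * w p.2 /\
  rots c t ps w p.2 = c * w p.2 - t * w p.1.
Proof.
elim: ps => //= q ps IH.
rewrite mem_cat in_cons !negb_or -!andbA => /and4P[q1 q12 q1' u].
have {u} : uniq (q.2 :: unzip1 ps ++ unzip2 ps).
  by rewrite (perm_uniq (s2 := unzip1 ps ++ q.2 :: unzip2 ps))//
    -cat1s perm_catCA.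
rewrite /= mem_cat negb_or -!andbA => /and3P[q2 q2' u].
rewrite in_cons => /predU1P[->|pps].
  rewrite /pairrot !eqxx (eq_sym q.2) (negbTE q12).
  by rewrite !rots_out.
have p1 : p.1 \in unzip1 ps by apply: map_f.
have p2 : p.2 \in unzip2 ps by apply: map_f.
have [e1 e2] := IH u pps.
have ne x y (r : seq nat) : x \in r -> y \notin r -> (x == y) = false.
  by move=> xr yr; apply/eqP => xy; rewrite -xy xr in yr.
by rewrite /pairrot !(ne _ _ _ p1)// !(ne _ _ _ p2).
Qed.

End rotation_values.

(** * Log-sum-exp *)

Section log_sum_exp.
Context {R : realType}.
Local Notation RN := (nat -> R).
Implicit Types (w v : RN) (r : seq nat) (tau : R).

Definition sumexp tau r w : R := \sum_(j <- r) expR (tau * w j).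

Definition lse tau r w : R := ln (sumexp tau r w).

Lemma sumexp_ge0 tau r w : 0 <= sumexp tau r w.
Proof. by apply: sumr_ge0 => j _; exact: expR_ge0. Qed.

Lemma sumexp_gt0 tau r w : (0 < size r)%N -> 0 < sumexp tau r w.
Proof.
case: r => // j r _; rewrite /sumexp big_cons ltr_pwDl ?expR_gt0//.
exact: sumexp_ge0.
Qed.

Lemma plot_sumexp tau r : plot_measurable (sumexp tau r).
Proof.
apply: plot_sum => j; apply: plot_expR; apply: plotM; first exact: plot_cst.
exact: plot_coord.
Qed.

Lemma plot_lse tau r : plot_measurable (lse tau r).
Proof. by apply: plot_ln; exact: plot_sumexp. Qed.

Definition softmax tau r w j : R := expR (tau * w j) / sumexp tau r w.

Lemma softmax_ge0 tau r w j : 0 <= softmax tau r w j.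
Proof. by rewrite divr_ge0 ?expR_ge0 ?sumexp_ge0. Qed.

(** A convex function lies above its tangent, and the gradient of [lse] is [tau] times the softmax.
    With [z] the tangent increment, the softmax average of [tau * (v j - w j) - z] is 0, so summing
    [1 + x <= expR x] at these points gives the claim. *)
Lemma lse_convex tau r w v : (0 < size r)%N ->
  tau * \sum_(j <- r) softmax tau r w j * (v j - w j) <= lse tau r v - lse tau r w.
Proof.
move=> r0; have Dw := sumexp_gt0 tau w r0; have Dv := sumexp_gt0 tau v r0.
set z := tau * _.
rewrite lerBrDr -ler_expR expRD /lse !lnK ?posrE//.
have zE : z * sumexp tau r w =
    \sum_(j <- r) expR (tau * w j) * (tau * (v j - w j)).
  rewrite /z -mulrA mulr_suml mulr_sumr; apply: eq_bigr => j _.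
  by rewrite /softmax; field; rewrite gt_eqF.
have -> : expR z * sumexp tau r w =
    \sum_(j <- r) expR z * expR (tau * w j) * (1 + (tau * (v j - w j) - z)).
  transitivity (expR z * sumexp tau r w +
     expR z * (z * sumexp tau r w - z * sumexp tau r w)); first by ring.
  rewrite {1}zE /sumexp !mulr_sumr -sumrB mulr_sumr -big_split/=.
  by apply: eq_bigr => j _; ring.
apply: ler_sum => j _.
have -> : expR (tau * v j) =
    expR z * expR (tau * w j) * expR (tau * (v j - w j) - z).
  by rewrite -!expRD; congr expR; ring.
by rewrite ler_wpM2l ?mulr_ge0 ?expR_ge0// expR_ge1Dx.
Qed.

Lemma sqr_le_between (a x b : R) : a <= x -> x <= b -> x ^+ 2 <= a ^+ 2 + b ^+ 2.
Proof.
move=> ax xb; have [x0|x0] := leP 0 x.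
  have : x ^+ 2 <= b ^+ 2 by rewrite ler_sqr ?nnegrE// (le_trans x0).
  by have := sqr_ge0 a; lra.
have : (- x) ^+ 2 <= (- a) ^+ 2 by rewrite ler_sqr ?nnegrE; lra.
by rewrite !sqrrN; have := sqr_ge0 b; lra.
Qed.

(** Convexity places the difference between the directional derivatives at the two ends; which one
    dominates is unknown, so both squares are kept. *)
Lemma lse_diff_sqr tau r w v : (0 < size r)%N ->
  (lse tau r w - lse tau r v) ^+ 2 <= tau ^+ 2 *
    ((\sum_(j <- r) softmax tau r w j * (v j - w j)) ^+ 2 +
     (\sum_(j <- r) softmax tau r v j * (v j - w j)) ^+ 2).
Proof.
move=> r0; have h1 := lse_convex tau w v r0; have := lse_convex tau v w r0.
have -> : \sum_(j <- r) softmax tau r v j * (w j - v j) =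
    - \sum_(j <- r) softmax tau r v j * (v j - w j).
  by rewrite -sumrN; apply: eq_bigr => j _; ring.
rewrite mulrN => h2; rewrite mulrDr -!exprMn -[_ - _]opprB sqrrN.
by apply: sqr_le_between => //; lra.
Qed.

End log_sum_exp.

(** * Second moments of affine forms in Gaussian coordinates *)

Section gaussian_moments.
Context {R : realType} (s : R) (s0 : 0 < s).
Local Notation RN := (nat -> R).
Implicit Types (w v : RN) (l : seq nat) (ps : seq (nat * nat)) (f A : RN -> R).

Lemma giter_coord_sqr l a w : a \in l ->
  (giter s l (fun w => (w a ^+ 2)%:E) w <= (s ^+ 2)%:E)%E.
Proof.
move=> al.
have pg : ge0_plot (fun w : RN => (w a ^+ 2)%:E).
  by apply: ge0_plot_EFin => [|v]; [apply: plotX; exact: plot_coord|exact: sqr_ge0].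
have pl : perm_eq l (rem a l ++ [:: a]).
  by rewrite (perm_trans (perm_to_rem al))// perm_sym perm_catC.
rewrite (giter_perm _ pg pl) giter_cat.
apply: (@le_trans _ _ (giter s (rem a l) (fun=> (s ^+ 2)%:E) w)); last by rewrite giter_cst.
apply: giter_le => [||v].
- exact: ge0_plot_gint.
- by apply: ge0_plot_EFin => [|v]; [exact: plot_cst|exact: sqr_ge0].
- rewrite /= /gint /upd eqxx; exact: normal_second_moment.
Qed.

Definition indep_of l f := forall k x w, k \in l -> f (upd w k x) = f w.

(** Given the other coordinates, the form is affine in independent centred Gaussians, so the cross
    terms vanish; the coordinates are integrated out one by one. *)
Lemma giter_affine_sqr ps A (Q : nat * nat -> RN -> R) w :
  uniq (unzip2 ps) -> plot_measurable A -> (forall p, plot_measurable (Q p)) ->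
  indep_of (unzip2 ps) A -> (forall p, p \in ps -> indep_of (unzip2 ps) (Q p)) ->
  (giter s (unzip2 ps) (fun w => ((A w + \sum_(p <- ps) Q p w * w p.2) ^+ 2)%:E) w
   <= (A w ^+ 2 + s ^+ 2 * \sum_(p <- ps) Q p w ^+ 2)%:E)%E.
Proof.
move=> + + mQ; elim: ps A w => [|p ps IH] A w.
  by move=> *; rewrite /= !big_nil mulr0 !addr0.
rewrite /= => /andP[p2 u] mA iA iQ.
have iQ' q : q \in ps -> indep_of (unzip2 ps) (Q q).
  by move=> qps k x v kl; rewrite iQ// in_cons ?qps ?kl orbT.
(* The inner integrals do not see coordinate [p.2], so its term joins the constant part for the
   induction hypothesis. *)
pose A' v := A v + Q p v * v p.2.
have mA' : plot_measurable A'.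
  by apply: plotD => //; apply: plotM => //; exact: plot_coord.
have iA' : indep_of (unzip2 ps) A'.
  move=> k x v kl; rewrite /A' iA ?in_cons ?kl ?orbT//.
  rewrite iQ ?mem_head ?in_cons ?kl ?orbT//.
  rewrite /upd; case: eqP => // pk; by rewrite pk kl in p2.
pose B v := A' v ^+ 2 + s ^+ 2 * \sum_(q <- ps) Q q v ^+ 2.
have s20 : 0 <= s ^+ 2 by exact: sqr_ge0.
have mB : plot_measurable B.
  apply: plotD; first exact: plotX.
  by apply: plotM; [exact: plot_cst|apply: plot_sum => q; exact: plotX].
have B0 v : 0 <= B v.
  by rewrite addr_ge0 ?sqr_ge0// mulr_ge0// sumr_ge0// => q _; exact: sqr_ge0.
apply: (@le_trans _ _ (gint s p.2 (fun v => (B v)%:E) w)).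
  apply: gint_le.
  - apply: ge0_plot_giter; apply: ge0_plot_EFin => [|v]; last exact: sqr_ge0.
    apply: plotX; apply: plotD => //; apply: plot_sum => q.
    by apply: plotM => //; exact: plot_coord.
  - exact: ge0_plot_EFin.
  - move=> v; have := IH A' v u mA' iA' iQ'.
    set g1 := (X in (giter _ _ X _ <= _)%E -> _).
    set g2 := (X in _ -> (giter _ _ X _ <= _)%E).
    have -> // : g1 = g2.
    by apply/funext => v'; rewrite /g1 /g2 big_cons addrA.
rewrite /gint.
pose C := s ^+ 2 * \sum_(q <- ps) Q q w ^+ 2.
have C0 : 0 <= C by rewrite mulr_ge0// sumr_ge0// => q _; exact: sqr_ge0.
under eq_integral => x _.
  rewrite (_ : B _ = (A w + Q p w * x) ^+ 2 + C); last first.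
    rewrite /B /A' iA ?mem_head// iQ ?mem_head// {1}/upd eqxx.
    congr (_ + _ * _); apply: eq_big_seq => q qps.
    by rewrite iQ ?mem_head// in_cons qps orbT.
  rewrite EFinD; over.
rewrite ge0_integralD//=; last 2 first.
- by move=> x _; rewrite lee_fin sqr_ge0.
- apply/measurable_EFinP; apply: measurable_funX; exact: measurable_funD.
rewrite integral_cst//= probability_setT mule1.
rewrite big_cons mulrDr addrA EFinD leeD2r// [s ^+ 2 * _]mulrC.
exact: normal_affine_sqr.
Qed.

End gaussian_moments.

(** * Jensen and Cauchy-Schwarz inequalities for finite sums *)

Section weighted_sums.
Context {R : realFieldType} {I : Type}.
Implicit Types (r : seq I) (p x : I -> R).

(** Expand the nonnegative weighted sum of [(x i - M) ^+ 2], with [M] the weighted sum itself; a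
    total weight below 1 only helps. *)
Lemma sqr_weighted_sum_le r p x : (forall i, 0 <= p i) -> \sum_(i <- r) p i <= 1 ->
  (\sum_(i <- r) p i * x i) ^+ 2 <= \sum_(i <- r) p i * x i ^+ 2.
Proof.
move=> p0 p1.
have expand c : \sum_(i <- r) p i * (x i - c) ^+ 2 = \sum_(i <- r) p i * x i ^+ 2
    - 2 * c * (\sum_(i <- r) p i * x i) + c ^+ 2 * \sum_(i <- r) p i.
  by rewrite !mulr_sumr -sumrB -big_split/=; apply: eq_bigr => i _; ring.
set M := \sum_(i <- r) p i * x i in expand *.
have : 0 <= \sum_(i <- r) p i * (x i - M) ^+ 2.
  by apply: sumr_ge0 => i _; rewrite mulr_ge0// sqr_ge0.
rewrite expand.
have : M ^+ 2 * \sum_(i <- r) p i <= M ^+ 2 by rewrite ler_piMr// sqr_ge0.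
by rewrite expr2; lra.
Qed.

Lemma sum_sqr_weights_le1 r p : (forall i, 0 <= p i) ->
  \sum_(i <- r) p i <= 1 -> \sum_(i <- r) p i ^+ 2 <= 1.
Proof.
move=> p0 p1; have P0 (q : seq I) : 0 <= \sum_(i <- q) p i by exact: sumr_ge0.
apply: (@le_trans _ _ ((\sum_(i <- r) p i) ^+ 2)); last by rewrite expr_le1.
elim: r {p1} => [|i r IH]; first by rewrite !big_nil expr0n.
rewrite !big_cons sqrrD; have := mulr_ge0 (p0 i) (P0 r); lra.
Qed.

Lemma sqr_sum_le (n : nat) (x : nat -> R) :
  (\sum_(k < n) x k) ^+ 2 <= n%:R * \sum_(k < n) x k ^+ 2.
Proof.
elim: n => [|n IH]; first by rewrite !big_ord0 expr0n mul0r.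
rewrite !big_ord_recr/= -natr1.
set a := \sum_(k < n) x k in IH *; set b := \sum_(k < n) x k ^+ 2 in IH *.
have [n0|n0] := posnP n.
  have a0 : a = 0 by rewrite /a; case: (n) n0 => // _; rewrite big_ord0.
  have b0 : b = 0 by rewrite /b; case: (n) n0 => // _; rewrite big_ord0.
  by rewrite n0 a0 b0 !add0r mul1r.
have np : 0 < n%:R :> R by rewrite ltr0n.
have h : 2 * a * x n <= b + n%:R * x n ^+ 2.
  rewrite -(ler_pM2l np).
  have : 0 <= (a - n%:R * x n) ^+ 2 by exact: sqr_ge0.
  by rewrite sqrrB; move: IH; lra.
by rewrite sqrrD mulrDl mul1r mulrDr; lra.
Qed.

End weighted_sums.

(** * Numerical bounds for sine, cosine and pi *)

Section trigonometric_bounds.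
Context {R : realType}.
Implicit Types x : R.

Lemma sin_le_id x : 0 <= x -> sin x <= x.
Proof.
move=> x0; rewrite -subr_ge0; move: x x0.
apply: (@ge0_of_derive_ge0 R (fun x => x - sin x) (fun x => 1 - cos x)).
- by rewrite sin0 subr0.
- by move=> x _; rewrite subr_ge0 cos_le1.
Qed.

Lemma cos_ge_taylor2 x : 0 <= x -> 1 - x ^+ 2 / 2 <= cos x.
Proof.
move=> x0; rewrite -subr_ge0; move: x x0.
apply: (@ge0_of_derive_ge0 R (fun x => cos x - (1 - x ^+ 2 / 2)) (fun x => x - sin x)).
- by move=> x; apply: is_derive_eq; rewrite /GRing.scale/=; field.
- by rewrite cos0 expr0n mul0r subr0 subrr.
- by move=> x x0; rewrite subr_ge0 sin_le_id.
Qed.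

Lemma sin_ge_taylor3 x : 0 <= x -> x - x ^+ 3 / 6 <= sin x.
Proof.
move=> x0; rewrite -subr_ge0; move: x x0.
apply: (@ge0_of_derive_ge0 R (fun x => sin x - (x - x ^+ 3 / 6))
  (fun x => cos x - (1 - x ^+ 2 / 2))).
- by move=> x; apply: is_derive_eq; rewrite /GRing.scale/=; field.
- by rewrite sin0 expr0n mul0r !subr0.
- by move=> x x0; rewrite subr_ge0 cos_ge_taylor2.
Qed.

Lemma cos_le_taylor4 x : 0 <= x -> cos x <= 1 - x ^+ 2 / 2 + x ^+ 4 / 24.
Proof.
move=> x0; rewrite -subr_ge0; move: x x0.
apply: (@ge0_of_derive_ge0 R (fun x => 1 - x ^+ 2 / 2 + x ^+ 4 / 24 - cos x)
  (fun x => sin x - (x - x ^+ 3 / 6))).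
- by move=> x; apply: is_derive_eq; rewrite /GRing.scale/=; field.
- by rewrite cos0 !expr0n !mul0r subr0 addr0 subrr.
- by move=> x x0; rewrite subr_ge0 sin_ge_taylor3.
Qed.

(** The fourth-order Taylor bound makes the cosine of [8 / 5] negative, by a margin of about
    0.007. *)
Lemma pihalf_le : pi / 2 <= 8 / 5 :> R.
Proof.
rewrite leNgt; apply/negP => h.
have : 0 <= cos (8 / 5 : R).
  by apply: cos_ge0_pihalf; apply/andP; split; have := pihalf_ge1 R; lra.
have : cos (8 / 5 : R) <= 1 - (8 / 5) ^+ 2 / 2 + (8 / 5) ^+ 4 / 24.
  by apply: cos_le_taylor4; lra.
by lra.
Qed.

(** The sine part is at most [(pi / 2)^2 <= 2.56]. Since [1 - cos th] is of second order and [N]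
    exceeds [100 * m], the other part is at most [1.28 / 1000]. *)
Lemma small_angle (m N : nat) (th : R) :
  N = (100 * m.+1)%N -> th = pi / 2 / N%:R ->
  N%:R ^+ 2 * (sin th ^+ 2 + (1 - cos th) ^+ 2 * m%:R) <= 1281 / 500.
Proof.
move=> NE' thE.
have NE : N%:R = 100 * (m%:R + 1) :> R by rewrite NE' natrM natr1.
have N0 : 0 < N%:R :> R by rewrite NE' ltr0n.
have [p1 p2] := (pihalf_ge1 R, pihalf_le).
have m0 : 0 <= m%:R :> R by rewrite ler0n.
have Nth : N%:R * th = pi / 2 by rewrite thE mulrC divfK// gt_eqF.
have th0 : 0 < th by rewrite thE divr_gt0//; lra.
have thle : th <= pi / 2.
  by rewrite thE ler_pdivrMr// ler_peMr//; lra.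
have s0 : 0 <= sin th by apply: sin_ge0_pi; apply/andP; split; lra.
have c0 : 0 <= cos th by apply: cos_ge0_pihalf; apply/andP; split; lra.
have sth := sin_le_id (ltW th0).
have c1 : 0 <= 1 - cos th by rewrite subr_ge0 cos_le1.
have cth : 1 - cos th <= th ^+ 2 / 2 by have := cos_ge_taylor2 (ltW th0); lra.
have a1 : N%:R ^+ 2 * sin th ^+ 2 <= (8 / 5) ^+ 2.
  have h0 : 0 <= N%:R * sin th by rewrite mulr_ge0// ltW.
  have h1 : N%:R * sin th <= pi / 2 by rewrite -Nth ler_wpM2l// ltW.
  by rewrite -exprMn; nra.
have a2 : N%:R ^+ 2 * (1 - cos th) <= (8 / 5) ^+ 2 / 2.
  apply: (@le_trans _ _ (N%:R ^+ 2 * (th ^+ 2 / 2))).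
    by rewrite ler_wpM2l ?sqr_ge0.
  by rewrite mulrA -exprMn Nth; nra.
have a3 : m%:R * (1 - cos th) <= 1 / 1000.
  have N100 : 100 <= N%:R :> R by rewrite NE; lra.
  have : N%:R * (N%:R * (1 - cos th)) <= 128 / 100 by rewrite mulrA -expr2; lra.
  have : m%:R * (1 - cos th) <= N%:R * (1 - cos th) / 100.
    by rewrite mulrAC ler_wpM2r// NE; lra.
  have : 0 <= N%:R * (1 - cos th) by rewrite mulr_ge0// ltW.
  by nra.
have a4 : N%:R ^+ 2 * (1 - cos th) * (m%:R * (1 - cos th)) <= (8 / 5) ^+ 2 / 2 * (1 / 1000).
  by apply: ler_pM => //; rewrite mulr_ge0// ?sqr_ge0.
by move: a1 a4; lra.
Qed.

End trigonometric_bounds.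

(** * Fluctuations of a log-sum-exp *)

Section lse_rotation.
Context {R : realType} (s : R) (s0 : 0 < s) (tau : R).
Variables (S : seq nat) (ps : seq (nat * nat)) (l : seq nat).
Local Notation r1 := (S ++ unzip1 ps).
Local Notation r2 := (S ++ unzip2 ps).
Hypothesis (uS : uniq (S ++ (unzip1 ps ++ unzip2 ps))).
Hypothesis (ul : uniq l) (psl : {subset unzip1 ps ++ unzip2 ps <= l}).
Hypothesis (r1_gt0 : (0 < size r1)%N).
Local Notation RN := (nat -> R).
Implicit Types (c t : R) (w v : RN).

Let sn0 : s != 0. Proof. by rewrite gt_eqF. Qed.

Let u12 : uniq (unzip1 ps ++ unzip2 ps).
Proof. by move: uS; rewrite cat_uniq => /and3P[]. Qed.

Let u2 : uniq (unzip2 ps).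
Proof. by move: u12; rewrite cat_uniq => /and3P[]. Qed.

Let r1_notin2 k : k \in unzip2 ps -> k \notin r1.
Proof.
move=> k2; move: uS; rewrite catA cat_uniq => /and3P[_ /hasPn/(_ k k2)] //.
Qed.

Let S_out j : j \in S -> (j \notin unzip1 ps) * (j \notin unzip2 ps).
Proof.
move=> jS; move: uS; rewrite cat_uniq => /and3P[_ /hasPn h _].
by split; apply/negP => j1; have := h j; rewrite /= mem_cat j1 ?orbT jS => /(_ isT).
Qed.

Let ps1 p : p \in ps -> p.1 \in unzip1 ps. Proof. exact: map_f. Qed.
Let ps2 p : p \in ps -> p.2 \in unzip2 ps. Proof. exact: map_f. Qed.

Let psl' p : p \in ps -> [/\ p.1 != p.2, p.1 \in l & p.2 \in l].
Proof.
move=> pp; split; [|by apply: psl; rewrite mem_cat ps1|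
  by apply: psl; rewrite mem_cat ps2 ?orbT].
have := r1_notin2 (ps2 pp); rewrite mem_cat negb_or => /andP[_].
by apply: contraNneq => <-; exact: ps1.
Qed.

(** Up to the factor [tau], the derivative of [lse tau r1] at [w] along the displacement made by
    [rots c t ps]; the shared coordinates [S] do not move. *)
Definition dirsum c t w := \sum_(p <- ps)
  softmax tau r1 w p.1 * ((c - 1) * w p.1 + t * w p.2).

Lemma plot_dirsum c t : plot_measurable (dirsum c t).
Proof.
apply: plot_sum => p; apply: plotM.
  apply: plotM; last by apply: plotV; exact: plot_sumexp.
  by apply: plot_expR; apply: plotM; [exact: plot_cst|exact: plot_coord].
by apply: plotD; (apply: plotM; [exact: plot_cst|exact: plot_coord]).
Qed.

Lemma sum_softmax_ps_le1 w : \sum_(p <- ps) softmax tau r1 w p.1 <= 1.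
Proof.
rewrite -mulr_suml ler_pdivrMr ?sumexp_gt0// mul1r /sumexp big_cat/= big_map.
by rewrite lerDr sumexp_ge0.
Qed.

(** The second coordinates of the pairs contribute [t ^+ 2] times the sum of squared weights, at
    most 1. The drift along the first coordinates is bounded crudely, each weight by 1, at the cost
    of the factor [size ps]; this is affordable because [1 - c] is of second order in the angle. *)
Lemma giter_dirsum_sqr c t w :
  (giter s l (fun w => (dirsum c t w ^+ 2)%:E) w <=
   (s ^+ 2 * (t ^+ 2 + (1 - c) ^+ 2 * (size ps)%:R))%:E)%E.
Proof.
pose l' := [seq j <- l | j \notin unzip2 ps].
have pl : perm_eq l (l' ++ unzip2 ps).
  apply: uniq_perm => //.
    rewrite cat_uniq filter_uniq//= u2 andbT; apply/hasPn => j j2.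
    by rewrite mem_filter negb_and j2.
  move=> j; rewrite mem_cat mem_filter; case: (boolP (j \in unzip2 ps)) => j2.
    by rewrite orbT; apply: psl; rewrite mem_cat j2 orbT.
  by rewrite orbF.
have pd : ge0_plot (fun w => (dirsum c t w ^+ 2)%:E).
  apply: ge0_plot_EFin => [|v]; last exact: sqr_ge0.
  by apply: plotX; exact: plot_dirsum.
rewrite (giter_perm _ pd pl) giter_cat.
pose q (p : nat * nat) v := softmax tau r1 v p.1.
have mq p : plot_measurable (q p).
  apply: plotM; last by apply: plotV; exact: plot_sumexp.
  by apply: plot_expR; apply: plotM; [exact: plot_cst|exact: plot_coord].
have updr1 k x v j : k \in unzip2 ps -> j \in r1 -> upd v k x j = v j.
  move=> k2 j1; rewrite /upd; case: eqP => // jk.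
  by have := r1_notin2 k2; rewrite -jk j1.
have p1r1 p : p \in ps -> p.1 \in r1 by move=> pp; rewrite mem_cat ps1 ?orbT.
have iq p : p \in ps -> indep_of (unzip2 ps) (q p).
  move=> pp k x v k2; rewrite /q /softmax updr1 ?p1r1//; congr (_ / _).
  by apply: eq_big_seq => j j1; rewrite updr1.
pose A v := (c - 1) * \sum_(p <- ps) q p v * v p.1.
have mA : plot_measurable A.
  apply: plotM; first exact: plot_cst.
  by apply: plot_sum => p; apply: plotM => //; exact: plot_coord.
have iA : indep_of (unzip2 ps) A.
  move=> k x v k2; rewrite /A; congr (_ * _); apply: eq_big_seq => p pp.
  by rewrite iq// updr1 ?p1r1.
have s20 : 0 <= s ^+ 2 by exact: sqr_ge0.
pose B (v : RN) := s ^+ 2 * t ^+ 2 + (1 - c) ^+ 2 * \sum_(p <- ps) v p.1 ^+ 2.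
have c20 : 0 <= (1 - c) ^+ 2 by exact: sqr_ge0.
have mB : plot_measurable B.
  apply: plotD; first exact: plot_cst.
  apply: plotM; first exact: plot_cst.
  by apply: plot_sum => p; apply: plotX; exact: plot_coord.
have Q0 (v : RN) : 0 <= \sum_(p <- ps) v p.1 ^+ 2.
  by apply: sumr_ge0 => p _; exact: sqr_ge0.
have B0 v : 0 <= B v.
  by apply: addr_ge0; apply: mulr_ge0 => //; exact: sqr_ge0.
apply: (@le_trans _ _ (giter s l' (fun v => (B v)%:E) w)).
  apply: giter_le.
  - exact: ge0_plot_giter.
  - exact: ge0_plot_EFin.
  move=> v.
  rewrite (_ : (fun w => (dirsum c t w ^+ 2)%:E) = fun u =>
      ((A u + \sum_(p <- ps) (t * q p u) * u p.2) ^+ 2)%:E); last first.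
    apply/funext => u; rewrite /dirsum /A; congr ((_ ^+ 2)%:E).
    rewrite mulr_sumr -big_split/=; apply: eq_bigr => p _.
    by rewrite -/(q p u); ring.
  have itq p : p \in ps -> indep_of (unzip2 ps) (fun v => t * q p v).
    by move=> pp k x u k2; rewrite iq.
  apply: (le_trans (giter_affine_sqr s0 (Q := fun p v => t * q p v) v u2 mA
    (fun p => plotM (plot_cst t) (mq p)) iA itq)).
  have q0 p : 0 <= q p v by exact: softmax_ge0.
  have q1 := sum_softmax_ps_le1 v.
  rewrite lee_fin /B addrC lerD//.
    rewrite ler_wpM2l//.
    rewrite (eq_bigr (fun p => t ^+ 2 * q p v ^+ 2)); last by move=> p _; rewrite exprMn.
    rewrite -mulr_sumr ler_piMr ?sqr_ge0//; exact: sum_sqr_weights_le1.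
  rewrite /A exprMn -[c - 1]opprB sqrrN ler_wpM2l//.
  apply: (le_trans (sqr_weighted_sum_le _ q0 q1)).
  rewrite !big_seq; apply: ler_sum => p pp; rewrite ler_piMl ?sqr_ge0//.
  rewrite /q /softmax ler_pdivrMr ?sumexp_gt0// mul1r /sumexp.
  by rewrite (big_rem _ (p1r1 _ pp))/= lerDl sumexp_ge0.
rewrite /B (_ : (fun _ => _) = fun v : RN => ((s ^+ 2 * t ^+ 2)%:E +
   ((1 - c) ^+ 2)%:E * (\sum_(p <- ps) v p.1 ^+ 2)%:E)%E); last by [].
have pQ : ge0_plot (fun v : RN => (\sum_(p <- ps) v p.1 ^+ 2)%:E).
  apply: ge0_plot_EFin => //.
  by apply: plot_sum => p; apply: plotX; exact: plot_coord.
have pC : ge0_plot (fun _ : RN => (s ^+ 2 * t ^+ 2)%:E).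
  by apply: ge0_plot_EFin => [|_]; [exact: plot_cst|rewrite mulr_ge0 ?sqr_ge0].
rewrite giterD//; last first.
  split; last by move=> v; rewrite mule_ge0// lee_fin.
  rewrite (_ : (fun _ => _) = fun v : RN =>
    (((1 - c) ^+ 2 * \sum_(p <- ps) v p.1 ^+ 2)%:E)); last by [].
  have [] // : ge0_plot (fun v : RN => ((1 - c) ^+ 2 * \sum_(p <- ps) v p.1 ^+ 2)%:E).
  apply: ge0_plot_EFin => [|v]; last by rewrite mulr_ge0.
  apply: plotM; first exact: plot_cst.
  by apply: plot_sum => p; apply: plotX; exact: plot_coord.
rewrite giter_cst giterZ// giter_sum; last 2 first.
- by move=> p; apply: plotX; exact: plot_coord.
- by move=> p v; exact: sqr_ge0.
rewrite mulrDr EFinD leeD2l// mulrCA [leRHS]EFinM lee_wpmul2l//.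
apply: (@le_trans _ _ (\sum_(p <- ps) (s ^+ 2)%:E)%E).
  rewrite !big_seq; apply: lee_sum => p pp; apply: giter_coord_sqr => //.
  have [p12 p1l _] := psl' pp; rewrite mem_filter p1l andbT.
  apply/negP => p12'; have := r1_notin2 p12'; by rewrite p1r1.
by rewrite sumEFin lee_fin big_const_seq count_predT iter_addr_0 mulr_natr.
Qed.

Lemma lse_rot_step c t w : c ^+ 2 + t ^+ 2 = 1 ->
  (lse tau r1 w - lse tau r1 (rots c t ps w)) ^+ 2 <=
  tau ^+ 2 * (dirsum c t w ^+ 2 + dirsum c (- t) (rots c t ps w) ^+ 2).
Proof.
move=> ct; set v := rots c t ps w.
have restrict (q : nat -> R) : \sum_(j <- r1) q j * (v j - w j) =
    \sum_(p <- ps) q p.1 * (v p.1 - w p.1).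
  rewrite big_cat/= big_map big_seq big1 ?add0r// => j jS.
  by rewrite /v rots_out ?S_out// subrr mulr0.
apply: (le_trans (lse_diff_sqr tau w v r1_gt0)).
have -> : \sum_(j <- r1) softmax tau r1 w j * (v j - w j) = dirsum c t w.
  rewrite restrict /dirsum; apply: eq_big_seq => p pp; congr (_ * _).
  by rewrite /v (rots_pair c t w u12 pp).1; ring.
have -> : \sum_(j <- r1) softmax tau r1 v j * (v j - w j) = - dirsum c (- t) v.
  rewrite restrict /dirsum -sumrN; apply: eq_big_seq => p pp.
  rewrite -mulrN; congr (_ * _).
  have [e1 e2] := rots_pair c t w u12 pp.
  rewrite -/v in e1 e2.
  (* The inverse rotation recovers [w] from [v], so seen from [v] the displacement is the opposite
     of the one with sine [- t]. *)
  have : c * v p.1 - t * v p.2 = w p.1.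
    by rewrite e1 e2 -[RHS]mul1r -ct; ring.
  by move=> {1}<-; ring.
by rewrite sqrrN.
Qed.

Let step c t : RN -> R := fun v => (lse tau r1 v - lse tau r1 (rots c t ps v)) ^+ 2.

Let ge0_plot_step c t : ge0_plot (fun v => (step c t v)%:E).
Proof.
apply: ge0_plot_EFin => [|v]; last exact: sqr_ge0.
apply: plotX; apply: plotD; first exact: plot_lse.
apply: plotN; apply: (plot_comp (plot_lse tau r1)) => k; exact: plot_rots.
Qed.

Let giter_step c t w : c ^+ 2 + t ^+ 2 = 1 -> t != 0 ->
  (giter s l (fun v => (step c t v)%:E) w <=
   (2 * tau ^+ 2 * (s ^+ 2 * (t ^+ 2 + (1 - c) ^+ 2 * (size ps)%:R)))%:E)%E.
Proof.
move=> ct t0.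
have pd t' : ge0_plot (fun v => (dirsum c t' v ^+ 2)%:E).
  apply: ge0_plot_EFin => [|v]; last exact: sqr_ge0.
  by apply: plotX; exact: plot_dirsum.
have pdr : ge0_plot (fun v => (dirsum c (- t) (rots c t ps v) ^+ 2)%:E).
  by apply: (ge0_plot_comp (pd (- t))) => k; exact: plot_rots.
have pD := ge0_plotD (pd t) pdr.
have tau0 : 0 <= tau ^+ 2 by exact: sqr_ge0.
apply: (@le_trans _ _ (giter s l (fun v => (tau ^+ 2)%:E *
    ((dirsum c t v ^+ 2)%:E + (dirsum c (- t) (rots c t ps v) ^+ 2)%:E))%E w)).
  apply: giter_le => //.
  - split; last by move=> v; rewrite mule_ge0 ?lee_fin// addr_ge0 ?sqr_ge0.
    move=> d X phi mphi; apply: emeasurable_funM => //.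
    by have [m _] := pD; exact: m.
  - by move=> v; rewrite -EFinD -EFinM lee_fin lse_rot_step.
rewrite giterZ// giterD//.
(* Invariance removes the rotation from the far-end term, leaving the same second moment with
   [- t]. *)
rewrite (@giter_rots _ s c t ps l (fun v => (dirsum c (- t) v ^+ 2)%:E))//.
have := leeD (giter_dirsum_sqr c t w) (giter_dirsum_sqr c (- t) w).
rewrite -EFinD sqrrN => h.
rewrite [2 * _]mulrC -mulrA [leRHS]EFinM lee_wpmul2l// (le_trans h)// lee_fin.
by rewrite mulr_natl mulr2n.
Qed.

Let giter_iter_rots c t k g : c ^+ 2 + t ^+ 2 = 1 -> t != 0 -> ge0_plot g ->
  giter s l (fun v => g (iter k (rots c t ps) v)) = giter s l g.
Proof.
move=> ct t0; elim: k g => [//|k IH] g pg.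
have pgr : ge0_plot (fun v => g (rots c t ps v)).
  by apply: ge0_plot_comp => // j; exact: plot_rots.
by rewrite -(giter_rots (ps := ps) sn0 ct t0 psl' pg) -[RHS](IH _ pgr).
Qed.

Let iter_rots_out c t k w j : j \notin unzip1 ps -> j \notin unzip2 ps ->
  iter k (rots c t ps) w j = w j.
Proof. by move=> j1 j2; elim: k => //= k IH; rewrite rots_out. Qed.

Let iter_rots_pair (th : R) k w p : p \in ps ->
  iter k (rots (cos th) (sin th) ps) w p.1 =
    cos (k%:R * th) * w p.1 + sin (k%:R * th) * w p.2 /\
  iter k (rots (cos th) (sin th) ps) w p.2 =
    cos (k%:R * th) * w p.2 - sin (k%:R * th) * w p.1.
Proof.
move=> pp; elim: k => [|k [IH1 IH2]].
  by rewrite mul0r cos0 sin0 !mul1r !mul0r addr0 subr0.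
have [e1 e2] := rots_pair (cos th) (sin th) (iter k (rots (cos th) (sin th) ps) w) u12 pp.
rewrite !iterS e1 e2 IH1 IH2 -natr1 mulrDl mul1r cosD sinD.
by split; ring.
Qed.

(* Rotating every pair by a quarter turn in N equal steps carries the first
   log-sum-exp to the second; each step is controlled by convexity. *)
Lemma giter_lse_diff_sqr w :
  (giter s l (fun v => ((lse tau r1 v - lse tau r2 v) ^+ 2)%:E) w <=
   (tau ^+ 2 * s ^+ 2 * (1281 / 250))%:E)%E.
Proof.
(* A step count proportional to the number of pairs makes the drift negligible; the existential
   keeps [N] opaque. *)
have [N NE] : exists N, N = (100 * (size ps).+1)%N by exists (100 * (size ps).+1)%N.
have Ngt0 : (0 < N)%N by rewrite NE.
pose th : R := pi / 2 / N%:R.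
have N0 : 0 < N%:R :> R by rewrite ltr0n.
have Nth : N%:R * th = pi / 2 by rewrite /th mulrC divfK// gt_eqF.
pose c := cos th; pose t := sin th.
have ct : c ^+ 2 + t ^+ 2 = 1 by rewrite /c /t cos2Dsin2.
have t0 : t != 0.
  rewrite gt_eqF// /t; apply: sin_gt0_pi; have p0 := pi_gt0 R.
  rewrite divr_gt0//= ?ltr_pdivrMr//; last by lra.
  have : 1 <= N%:R :> R by rewrite ler1n.
  by nra.
pose rot := rots c t ps.
(* After a quarter turn the coordinate [p.1] holds the former value of [p.2]. *)
have lseN v : lse tau r2 v = lse tau r1 (iter N rot v).
  congr ln; rewrite /sumexp !big_cat/= !big_map; congr (_ + _).
    by apply: eq_big_seq => j jS; rewrite /rot iter_rots_out// S_out.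
  apply: eq_big_seq => p pp.
  by rewrite (iter_rots_pair th N v pp).1 Nth cos_pihalf sin_pihalf mul0r mul1r add0r.
have tele n v : lse tau r1 v - lse tau r1 (iter n rot v) =
    \sum_(k < n) (lse tau r1 (iter k rot v) - lse tau r1 (iter k.+1 rot v)).
  elim: n => [|n IH]; first by rewrite big_ord0 subrr.
  by rewrite big_ord_recr/= -IH; ring.
have pst k : ge0_plot (fun v => (step c t (iter k rot v))%:E).
  apply: (ge0_plot_comp (ge0_plot_step c t)) => j.
  elim: k j => [|k IH] j /=; first exact: plot_coord.
  exact: (plot_comp (plot_rots c t ps j)).
have plotst k : plot_measurable (fun v => step c t (iter k rot v)).
  move=> d X phi mphi; apply/measurable_EFinP; have [m _] := pst k; exact: m.
apply: (@le_trans _ _ (giter s l (fun v => N%:R%:E *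
    (\sum_(k < N) step c t (iter k rot v))%:E)%E w)).
  apply: giter_le.
  - apply: ge0_plot_EFin => [|v]; last exact: sqr_ge0.
    by apply: plotX; apply: plotD; [|apply: plotN]; exact: plot_lse.
  - rewrite (_ : (fun _ => _) = fun v =>
      (N%:R * (\sum_(k < N) step c t (iter k rot v)))%:E); last by [].
    apply: ge0_plot_EFin => [|v].
      by apply: plotM; [exact: plot_cst|exact: plot_sum].
    by apply: mulr_ge0; [exact: ltW|apply: sumr_ge0 => k _; exact: sqr_ge0].
  (* Cauchy-Schwarz on the telescoping sum costs a factor [N]; the [N] expected squares are of order
     [N^-2], so the total stays bounded. *)
  - move=> v; rewrite -EFinM lee_fin lseN tele; exact: (@sqr_sum_le _ N (fun k =>
      lse tau r1 (iter k rot v) - lse tau r1 (iter k.+1 rot v))).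
rewrite giterZ ?(ltW N0)//; last first.
  apply: ge0_plot_EFin => [|v]; first exact: plot_sum.
  by apply: sumr_ge0 => k _; exact: sqr_ge0.
rewrite giter_sum//; last by move=> k v; exact: sqr_ge0.
(* By invariance every step has the same expectation as the first one. *)
under eq_bigr => k _ do rewrite (giter_iter_rots k ct t0 (ge0_plot_step c t)).
set K := 2 * tau ^+ 2 * (s ^+ 2 * (t ^+ 2 + (1 - c) ^+ 2 * (size ps)%:R)).
apply: (@le_trans _ _ (N%:R%:E * \sum_(k < N) K%:E)%E).
  rewrite lee_wpmul2l ?lee_fin ?(ltW N0)//; apply: lee_sum => k _.
  exact: giter_step.
rewrite sumEFin -EFinM lee_fin sumr_const card_ord -mulr_natr.
have := small_angle NE (erefl th); rewrite -/c -/t => h.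
rewrite [leLHS](_ : _ = 2 * (tau ^+ 2 * s ^+ 2) *
  (N%:R ^+ 2 * (t ^+ 2 + (1 - c) ^+ 2 * (size ps)%:R))); last by rewrite /K; ring.
have ts : 0 <= tau ^+ 2 * s ^+ 2 by rewrite mulr_ge0 ?sqr_ge0.
by have := ler_wpM2l ts h; lra.
Qed.

End lse_rotation.

(** * Correlations and the stationary distribution *)

Section uniform_covariance.
Context {R : realType} {n : nat} (n_gt0 : (0 < n)%N).
Implicit Types (x y : 'I_n -> R) (c : R).

Let nR : 0 < n%:R :> R. Proof. by rewrite ltr0n. Qed.
Let nR0 : n%:R != 0 :> R. Proof. by rewrite gt_eqF. Qed.

Lemma umeanE x : n%:R * umean x = \sum_i x i.
Proof. by rewrite /umean mulrC divfK. Qed.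

Lemma umeanD x y : umean (fun i => x i + y i) = umean x + umean y.
Proof. by rewrite /umean big_split mulrDl. Qed.

Lemma umeanZ c x : umean (fun i => c * x i) = c * umean x.
Proof. by rewrite /umean -mulr_sumr mulrA. Qed.

Lemma umean_cst c : umean (fun _ : 'I_n => c) = c.
Proof. by rewrite /umean sumr_const card_ord -[c *+ n]mulr_natr mulfK. Qed.

Lemma ucorrDc x y c : ucorr (fun i => x i + c) y = ucorr x y.
Proof.
have e : umean (fun i => x i + c) = umean x + c by rewrite umeanD umean_cst.
have -> : ucorr (fun i => x i + c) y = ucov x y / Num.sqrt (ucov x x * ucov y y).
  rewrite /ucorr; congr (_ / Num.sqrt (_ * _)); rewrite /ucov e; congr (_ / _);
    by apply: eq_bigr => i _; ring.
by [].
Qed.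

Lemma ucov_ge0 x : 0 <= ucov x x.
Proof.
by rewrite divr_ge0 ?ler0n// sumr_ge0// => i _; rewrite -expr2 sqr_ge0.
Qed.

Lemma ucov_sqr x : ucov x x = (\sum_i (x i - umean x) ^+ 2) / n%:R.
Proof. by congr (_ / _); apply: eq_bigr => i _; rewrite expr2. Qed.

Lemma ucov_eq0 x : ucov x x = 0 -> forall i j, x i = x j.
Proof.
rewrite ucov_sqr => /eqP; rewrite mulf_eq0 invr_eq0 pnatr_eq0.
rewrite (gtn_eqF n_gt0) orbF psumr_eq0; last by move=> i _; exact: sqr_ge0.
move=> /allP h.
have e i : x i = umean x.
  by have := h i (mem_index_enum i); rewrite /= sqrf_eq0 subr_eq0 => /eqP.
by move=> i j; rewrite e (e j).
Qed.

Lemma sum_sqr_sub x c : \sum_i (x i - c) ^+ 2 =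
  \sum_i x i ^+ 2 - 2 * c * \sum_i x i + n%:R * c ^+ 2.
Proof.
rewrite (_ : n%:R * c ^+ 2 = \sum_(i < n) c ^+ 2); last first.
  by rewrite sumr_const card_ord mulr_natl.
by rewrite mulr_sumr -sumrB -big_split/=; apply: eq_bigr => i _; ring.
Qed.

Lemma ucov_moments x : ucov x x = (\sum_i x i ^+ 2) / n%:R - umean x ^+ 2.
Proof.
rewrite ucov_sqr sum_sqr_sub -umeanE; field; exact: nR0.
Qed.

Lemma ucov_le_center x c : ucov x x <= (\sum_i (x i - c) ^+ 2) / n%:R.
Proof.
rewrite ucov_moments sum_sqr_sub -umeanE.
rewrite [leRHS](_ : _ = (\sum_i x i ^+ 2) / n%:R - umean x ^+ 2 + (umean x - c) ^+ 2).
  by rewrite lerDl sqr_ge0.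
by field; exact: nR0.
Qed.

(** This form turns a bound on each [L_i - L_k] into one on the variance of [L], without
    centring. *)
Lemma ucov_pairs x :
  ucov x x = (\sum_i \sum_k (x i - x k) ^+ 2) / (2 * n%:R ^+ 2).
Proof.
have -> : \sum_i \sum_k (x i - x k) ^+ 2 =
    2 * n%:R * (\sum_i x i ^+ 2) - 2 * (\sum_i x i) ^+ 2.
  transitivity (\sum_i (\sum_k x k ^+ 2 - 2 * x i * \sum_k x k + n%:R * x i ^+ 2)).
    apply: eq_bigr => i _; rewrite -sum_sqr_sub.
    by apply: eq_bigr => k _; rewrite -sqrrN opprB.
  rewrite big_split/= sumrB sumr_const card_ord -mulr_suml -!mulr_sumr -mulr_natl.
  by ring.
by rewrite ucov_moments -umeanE; field; exact: nR0.
Qed.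

Lemma ucov_cauchy x y : ucov x y ^+ 2 <= ucov x x * ucov y y.
Proof.
have disc t : 0 <= ucov x x + 2 * t * ucov x y + t ^+ 2 * ucov y y.
  have -> : ucov x x + 2 * t * ucov x y + t ^+ 2 * ucov y y =
      (\sum_i ((x i - umean x) + t * (y i - umean y)) ^+ 2) / n%:R.
    rewrite /ucov !mulrA -!mulrDl; congr (_ / _).
    by rewrite !mulr_sumr -!big_split/=; apply: eq_bigr => i _; ring.
  by rewrite divr_ge0 ?ler0n// sumr_ge0// => i _; exact: sqr_ge0.
have y0 := ucov_ge0 y; have x0 := ucov_ge0 x.
have [yz|yn0] := eqVneq (ucov y y) 0.
  rewrite yz mulr0; have [->|cn0] := eqVneq (ucov x y) 0; first by rewrite expr0n.
  (* The quadratic has degenerated to an affine function of [t]; this point gives it the value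
     -1. *)
  have := disc (- (ucov x x + 1) / (2 * ucov x y)); rewrite yz mulr0 addr0.
  rewrite (_ : 2 * _ * _ = - (ucov x x + 1)); first by lra.
  by field.
have yp : 0 < ucov y y by rewrite lt_neqAle eq_sym yn0.
have := disc (- ucov x y / ucov y y).
rewrite (_ : _ + _ = (ucov x x * ucov y y - ucov x y ^+ 2) / ucov y y).
  by rewrite pmulr_lge0 ?invr_gt0// subr_ge0.
by field.
Qed.

Lemma ucov_shift_scale x y lam :
  ucov (fun i => y i - lam * x i) (fun i => y i - lam * x i) =
  ucov y y - 2 * lam * ucov x y + lam ^+ 2 * ucov x x.
Proof.
have e : umean (fun i => y i - lam * x i) = umean y - lam * umean x.
  rewrite -mulNr -umeanZ -umeanD; congr umean; apply/funext => i; ring.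
rewrite /ucov e; move: (umean x) (umean y) => a b.
rewrite [2 * lam * (_ / _)]mulrA [lam ^+ 2 * (_ / _)]mulrA -mulrBl -mulrDl.
congr (_ / _); rewrite !mulr_sumr -sumrB -big_split/=.
by apply: eq_bigr => i _; ring.
Qed.

End uniform_covariance.

(** * From covariances to the deficit of a correlation *)

Section correlation.
Context {R : rcfType}.
Implicit Types A B C lam : R.

Lemma corr_le1 A B C : C ^+ 2 <= A * B -> -1 <= C / Num.sqrt (A * B) <= 1.
Proof.
move=> CAB; have AB0 : 0 <= A * B by apply: le_trans CAB; exact: sqr_ge0.
rewrite -ler_norml normrM normfV (ger0_norm (sqrtr_ge0 _)).
have [->|s0] := eqVneq (Num.sqrt (A * B)) 0; first by rewrite invr0 mulr0 ler01.
rewrite ler_pdivrMr ?mul1r ?lt_neqAle ?sqrtr_ge0 ?andbT 1?eq_sym//.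
by rewrite -sqrtr_sqr ler_wsqrtr.
Qed.

(** Here [A], [B], [C] stand for [Var W], [Var Y], [Cov (W, Y)], and the numerator contains
    [Var (Y - lam W)]. If [C >= 0] and [B > 0], then [1 - r <= 1 - r^2], and [(1 - r^2) * lam^2 * A]
    is the residual variance of [lam W] regressed on [Y], at most [Var (Y - lam W)]. The factor 2
    serves [C < 0], where the deficit can reach 2 but [Var (Y - lam W)] is at least [lam^2 * A]. *)
Lemma corr_deficit A B C lam : 0 < A -> 0 <= B -> C ^+ 2 <= A * B -> 0 < lam ->
  1 - C / Num.sqrt (A * B) <= 2 * (B - 2 * lam * C + lam ^+ 2 * A) / (lam ^+ 2 * A).
Proof.
move=> A0 B0 CAB l0; have /andP[r1 r2] := corr_le1 CAB.
have lA : 0 < lam ^+ 2 * A by rewrite mulr_gt0// exprn_gt0.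
set r := C / _ in r1 r2 *.
have [C0|C0] := ltP C 0.
  rewrite ler_pdivlMr//.
  have : 0 <= - (lam * C) by rewrite oppr_ge0 pmulr_rle0// ltW.
  by nra.
move: B0; rewrite le_eqVlt => /predU1P[B0|B0].
  have C2 : C = 0.
    by apply/eqP; rewrite -sqrf_eq0 eq_le sqr_ge0 andbT (le_trans CAB)// -B0 mulr0.
  rewrite /r -B0 C2 mul0r subr0 mulr0 subr0 add0r mulfK ?gt_eqF//; lra.
have s0 : 0 < Num.sqrt (A * B) by rewrite sqrtr_gt0 mulr_gt0.
have r0 : 0 <= r by rewrite divr_ge0// ltW.
have r2E : r ^+ 2 = C ^+ 2 / (A * B) by rewrite exprMn exprVn sqr_sqrtr// mulr_ge0// ltW.
apply: (@le_trans _ _ (1 - r ^+ 2)); first by nra.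
have sq : 0 <= (B - lam * C) ^+ 2 / B by rewrite divr_ge0 ?sqr_ge0// ltW.
have q0 : 0 <= B - 2 * lam * C + lam ^+ 2 * A.
  have : 0 <= (A * B - C ^+ 2) / B by rewrite divr_ge0 ?subr_ge0// ltW.
  have : B - 2 * lam * C + lam ^+ 2 * A =
    (B - lam * C) ^+ 2 / B + lam ^+ 2 * ((A * B - C ^+ 2) / B).
    by field; rewrite gt_eqF.
  by move=> -> h; rewrite addr_ge0// mulr_ge0// sqr_ge0.
rewrite ler_pdivlMr// r2E.
have -> : (1 - C ^+ 2 / (A * B)) * (lam ^+ 2 * A) = B - 2 * lam * C + lam ^+ 2 * A
   - (B - lam * C) ^+ 2 / B.
  by field; rewrite !gt_eqF.
lra.
Qed.

End correlation.

(** * Reversibility and uniqueness of the stationary distribution *)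

Section random_energy_chain.
Context {R : realType} {n : nat} (G : rel 'I_n) (lam : R) (W : 'I_n -> R).
Hypotheses (G_simple : simple_graph G) (G_conn : graph_connected G).
Hypothesis (n_gt0 : (0 < n)%N).

Local Notation Q := (REM G lam W).
Local Notation Z := (\sum_i expR (- W i)).

Lemma exit_rate_REM i : exit_rate G Q i =
  expR (lam * W i) * \sum_(j | G i j) expR (- (1 - lam) * W j).
Proof.
rewrite /exit_rate mulr_sumr; apply: eq_bigr => j Gij.
by rewrite /REM Gij -expRD; congr expR; ring.
Qed.

Let Z_gt0 : 0 < Z.
Proof.
rewrite (bigD1 (Ordinal n_gt0))//= ltr_pwDl ?expR_gt0//.
by apply: sumr_ge0 => i _; exact: expR_ge0.
Qed.

(** The conductance of an edge, [expR (- W i)] times the rate from [i] to [j]; its symmetry in [i]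
    and [j] is reversibility. *)
Let cond i j : R := expR (- (1 - lam) * (W i + W j)).

(* Detailed balance in terms of the density with respect to [expR (- W i)]. *)
Let balanceE (p u : 'I_n -> R) i : (forall j, p j = u j * expR (- W j)) ->
  \sum_(j | G j i) p j * Q j i - p i * exit_rate G Q i =
  \sum_(j | G i j) cond i j * (u j - u i).
Proof.
move=> pE; rewrite /exit_rate mulr_sumr.
rewrite (eq_bigl (fun j => G i j)); last by move=> j; rewrite G_simple.1.
rewrite -sumrB; apply: eq_bigr => j Gij.
have Gji : G j i by rewrite G_simple.1.
have e a b : expR (- W a) * expR (lam * W a - (1 - lam) * W b) = cond a b.
  by rewrite -expRD; congr expR; ring.
have condC : cond j i = cond i j by rewrite /cond [W j + _]addrC.
have eQ a b : G a b -> p a * Q a b = u a * cond a b.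
  by move=> Gab; rewrite /REM Gab pE -mulrA e.
by rewrite !eQ// condC; ring.
Qed.

Let gibbs_stationary : is_stationary G Q (fun i => expR (- W i) / Z).
Proof.
split; first by move=> i; rewrite divr_ge0 ?expR_ge0// ltW.
split; first by rewrite -mulr_suml divff// gt_eqF.
move=> i; apply/eqP; rewrite -subr_eq0.
rewrite (balanceE (u := fun=> Z^-1)); last by move=> j; rewrite mulrC.
by rewrite big1// => j _; rewrite subrr mulr0.
Qed.

(** Maximum principle: at a maximiser all summands are nonpositive and add up to 0, so the
    neighbours are maximisers too, and connectedness spreads this to every vertex. *)
Let harmonic_cst (u : 'I_n -> R) :
  (forall i, \sum_(j | G i j) cond i j * (u j - u i) = 0) ->
  forall i j, u i = u j.
Proof.
move=> uh; pose i0 := Ordinal n_gt0.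
have [m _ /= mmax] := @arg_maxP _ _ _ i0 predT u isT.
have step i j : G i j -> u i = u m -> u j = u m.
  move=> Gij ui; have := uh i.
  move/eqP; rewrite -oppr_eq0 -sumrN psumr_eq0; last first.
    move=> k _; rewrite -mulrN mulr_ge0 ?expR_ge0// opprB subr_ge0 ui.
    exact: mmax.
  move/allP/(_ j); rewrite mem_index_enum => /(_ isT)/implyP/(_ Gij).
  by rewrite oppr_eq0 mulf_eq0 gt_eqF ?expR_gt0//= subr_eq0 => /eqP ->.
have um k : u k = u m.
  have /connectP[pth + ->] := G_conn m k.
  have : u m = u m by [].
  elim: pth {1 3 4}m => [//|j pth IH] i ui /= /andP[Gij pj].
  by apply: IH => //; exact: step ui.
by move=> i j; rewrite (um i) (um j).
Qed.

(** [epsilon] returns some stationary law because the Gibbs law is one; the density of any such law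
    with respect to [expR (- W i)] is harmonic, hence constant. *)
Lemma stationary_REM i : stationary G Q i = expR (- W i) / Z.
Proof.
have : is_stationary G Q (stationary G Q).
  apply: ClassicalEpsilon.epsilon_spec.
  by exists (fun i => expR (- W i) / Z); exact: gibbs_stationary.
set p := stationary G Q; case=> [_ [p1 pb]].
pose u j := p j * expR (W j).
have pE j : p j = u j * expR (- W j) by rewrite /u -mulrA -expRD subrr expR0 mulr1.
have uc : forall i j, u i = u j.
  apply: harmonic_cst => k; rewrite -(balanceE k pE) pb subrr//.
have uZ : u i * Z = 1.
  rewrite -p1 mulr_sumr; apply: eq_bigr => j _; by rewrite pE (uc i j).
rewrite pE mulrC; congr (_ * _); apply: (mulIf (lt0r_neq0 Z_gt0)).
by rewrite uZ mulVf// gt_eqF.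
Qed.

Lemma lnN_stationary_REM i : - ln (stationary G Q i) = W i + ln Z.
Proof.
rewrite stationary_REM lnM ?posrE ?expR_gt0 ?invr_gt0// lnV ?posrE// expRK.
ring.
Qed.

End random_energy_chain.

(** * Products of coordinate functions, and a null event *)

Section gaussian_tails.
Context {R : realType} (s : R) (s0 : 0 < s).
Local Notation RN := (nat -> R).

Lemma giter_prod (phi : R -> R) (kappa : R) n w :
  measurable_fun [set: R] phi -> (forall x, 0 <= phi x) -> 0 <= kappa ->
  (\int[normal_prob 0 s]_x (phi x)%:E = kappa%:E)%E ->
  giter s (iota 0 n) (fun w : RN => (\prod_(i < n) phi (w i))%:E) w =
  (kappa ^+ n)%:E.
Proof.
move=> mphi phi0 k0 int.
have P0 m (v : RN) : 0 <= \prod_(i < m) phi (v i) by apply: prodr_ge0.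
have mP m : plot_measurable (fun v : RN => \prod_(i < m) phi (v i)).
  elim: m => [|m IH].
    rewrite (_ : (fun _ => _) = fun=> 1); first exact: plot_cst.
    by apply/funext => v; rewrite big_ord0.
  rewrite (_ : (fun _ => _) = fun v : RN => (\prod_(i < m) phi (v i)) * phi (v m)).
    apply: plotM => // d X f mf; exact: (measurableT_comp mphi (mf m)).
  by apply/funext => v; rewrite big_ord_recr.
elim: n w => [|n IH] w; first by rewrite /= big_ord0.
rewrite -addn1 iotaD giter_cat add0n addn1.
rewrite (_ : giter s (iota n 1) _ =
  fun v => (kappa%:E * (\prod_(i < n) phi (v i))%:E)%E); last first.
  apply/funext => v; rewrite /= /gint.
  have E x : \prod_(i < n.+1) phi (upd v n x i) = (\prod_(i < n) phi (v i)) * phi x.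
    rewrite big_ord_recr/= {2}/upd eqxx; congr (_ * _); apply: eq_bigr => i _.
    by rewrite /upd ltn_eqF.
  under eq_integral => x _ do rewrite E EFinM.
  rewrite ge0_integralZl//=.
  - by rewrite int muleC.
  - exact/measurable_EFinP.
  - by move=> x _; rewrite lee_fin.
  - by rewrite lee_fin P0.
rewrite giterZ//; last exact: ge0_plot_EFin.
by rewrite IH -EFinM exprS.
Qed.

(** With [w j] frozen, coordinate [k] would have to hit a single point, and the normal law has no
    atoms. *)
Lemma giter_coord_eq l j k w : j != k -> k \in l ->
  giter s l (fun w : RN => (\1_([set 0 : R]%classic) (w j - w k) : R)%:E) w = 0%E.
Proof.
move=> jk kl.
have pn : ge0_plot (fun w : RN => (\1_([set 0 : R]%classic) (w j - w k) : R)%:E).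
  apply: ge0_plot_EFin => [d X phi mphi|v]; last by rewrite indicE ler0n.
  have mi : measurable_fun setT (\1_([set 0 : R]%classic) : R -> R).
    exact: measurable_indic.
  by apply: (measurableT_comp mi); apply: measurable_funB; exact: mphi.
have pl : perm_eq l (rem k l ++ [:: k]).
  by rewrite (perm_trans (perm_to_rem kl))// perm_sym perm_catC.
rewrite (giter_perm _ pn pl) giter_cat.
rewrite (_ : giter s [:: k] _ = fun=> 0%E) ?giter_cst//.
apply/funext => v; rewrite /= /gint.
transitivity (\int[normal_prob 0 s]_x (\1_[set v j]%classic x)%:E)%E.
  apply: eq_integral => x _; rewrite /upd eqxx (negbTE jk) !indicE; congr (_%:R%:E).
  congr nat_of_bool; apply/idP/idP; rewrite !inE/= => /eqP.
    by rewrite subr_eq0 => /eqP ->.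
  by move=> /eqP ->; rewrite subrr.
by rewrite integral_indic//= setIT /normal_prob integral_set1.
Qed.

End gaussian_tails.

Section one_minus.
Context {R : realType} (s : R).
Local Notation RN := (nat -> R).

Lemma gint_one_minus k (g : RN -> \bar R) : ge0_plot g ->
  (forall w, g w <= 2%:E)%E ->
  gint s k (fun w => 1 - g w)%E = (fun w => 1 - gint s k g w)%E.
Proof.
move=> [mg g0] g2; apply/funext => w; rewrite /gint.
have mu : measurable_fun setT (fun x : measurableTypeR R => g (upd w k x)).
  apply: (mg _ (measurableTypeR R)) => j; rewrite /upd.
  by case: (j == k); [exact: measurable_id|exact: measurable_cst].
have i2 (c : R) : (normal_prob 0 s).-integrable setT (fun _ : measurableTypeR R => c%:E).
  by apply: finite_measure_integrable_cst.
rewrite integralB//; last first.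
  apply: (le_integrable measurableT mu _ (i2 2)) => x _ /=.
  by rewrite gee0_abs// ger0_norm.
by rewrite integral_cst//= probability_setT mule1.
Qed.

(** Passes from the signed integrand [rho] to the nonnegative [1 - rho]; boundedness by 2 supplies
    the integrability needed at each coordinate. *)
Lemma giter_one_minus l (f : RN -> R) w : plot_measurable f ->
  (forall w, -1 <= f w <= 1) ->
  giter s l (fun w => (f w)%:E) w = (1 - giter s l (fun w => (1 - f w)%:E) w)%E.
Proof.
move=> mf f1.
have pg : ge0_plot (fun w => (1 - f w)%:E).
  apply: ge0_plot_EFin => [|v]; last by have /andP[] := f1 v; lra.
  by apply: plotD; [exact: plot_cst|exact: plotN].
have p2 : ge0_plot (fun _ : RN => (2 : R)%:E).
  by apply: ge0_plot_EFin => [|_]; [exact: plot_cst|].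
suff -> : giter s l (fun w => (f w)%:E) =
  (fun w => 1 - giter s l (fun w => (1 - f w)%:E) w)%E by [].
elim: l => [|k l IH] /=.
  by apply/funext => v; rewrite -EFinB; congr EFin; ring.
rewrite IH gint_one_minus//; first exact: ge0_plot_giter.
move=> v; apply: (@le_trans _ _ (giter s l (fun=> 2%:E) v)).
  by apply: giter_le => // u; rewrite lee_fin; have /andP[] := f1 u; lra.
by rewrite giter_cst.
Qed.

End one_minus.

Section geometric_decay.
Context {R : realType}.

Lemma geometric_decay (kappa : R) : 0 < kappa -> kappa < 1 ->
  exists2 D : R, 0 <= D &
    forall n : nat, (0 < n)%N -> n%:R * kappa ^+ n <= D / Num.sqrt n%:R.
Proof.
move=> k0 k1; pose eta := - ln kappa.
have eta0 : 0 < eta by rewrite oppr_gt0 ln_lt0// k0.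
(* From [expR x >= x^2 / 2] at [x = eta * n], which even gives decay of order [1 / n]. *)
exists (2 / eta ^+ 2); first by rewrite divr_ge0 ?sqr_ge0.
move=> n n0; have nR : 1 <= n%:R :> R by rewrite ler1n.
have nR0 : 0 < n%:R :> R by apply: lt_le_trans nR.
have -> : kappa ^+ n = (expR (eta * n%:R))^-1.
  by rewrite -expRN /eta mulNr opprK mulr_natr -lnXn// lnK// posrE exprn_gt0.
have e : (eta * n%:R) ^+ 2 / 2 <= expR (eta * n%:R).
  have : 0 <= eta * n%:R by rewrite mulr_ge0// ltW.
  by move=> /(expR_ge1Dxn 1); rewrite (_ : 2`! = 2)//; lra.
have x0 : 0 < (eta * n%:R) ^+ 2 / 2 by rewrite divr_gt0// exprn_gt0// mulr_gt0.
apply: (@le_trans _ _ (n%:R * ((eta * n%:R) ^+ 2 / 2)^-1)).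
  by rewrite ler_wpM2l ?(ltW nR0)// lef_pV2 ?posrE ?expR_gt0.
have -> : n%:R * ((eta * n%:R) ^+ 2 / 2)^-1 = 2 / eta ^+ 2 / n%:R.
  by field; rewrite !gt_eqF.
rewrite ler_wpM2l ?divr_ge0 ?sqr_ge0// lef_pV2 ?posrE ?sqrtr_gt0//.
rewrite -[leRHS](@ger0_norm _ n%:R) ?(ltW nR0)// -sqrtr_sqr ler_wsqrtr// expr2.
by rewrite ler_peMr// (ltW nR0).
Qed.

End geometric_decay.

(** * The correlation of the random energy chain *)

Section neighbourhood_lse.
Context {R : realType} {n : nat} (G : rel 'I_n).
Implicit Types (W : 'I_n -> R) (i k : 'I_n) (lam tau s : R).

Definition nlse tau W i : R := ln (\sum_(j | G i j) expR (tau * W j)).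

Lemma connected_neighbour : (1 < n)%N -> graph_connected G ->
  forall i, exists j, G i j.
Proof.
move=> n1 Gc i.
have [k ki] : exists k, k != i.
  have n0 : (0 < n)%N by exact: ltnW.
  case: (eqVneq (Ordinal n0) i) => [<-|ne]; last by exists (Ordinal n0).
  by exists (Ordinal n1).
have /connectP[[|j p] /=] := Gc i k; first by move=> _ e; rewrite e eqxx in ki.
by move=> /andP[Gij _] _; exists j.
Qed.

Hypotheses (G_simple : simple_graph G) (G_conn : graph_connected G).
Hypothesis (n_gt1 : (1 < n)%N).
Let n_gt0 : (0 < n)%N. Proof. exact: ltnW. Qed.

Let sum_gt0 tau W i : 0 < \sum_(j | G i j) expR (tau * W j).
Proof.
have [j Gij] := connected_neighbour n_gt1 G_conn i.
rewrite (bigD1 j)//= ltr_pwDl ?expR_gt0//.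
by apply: sumr_ge0 => k _; exact: expR_ge0.
Qed.

Lemma rho_REM lam W : rho G (REM G lam W) =
  ucorr W (fun i => lam * W i + nlse (- (1 - lam)) W i).
Proof.
rewrite /rho -(ucorrDc n_gt0 W _ (ln (\sum_i expR (- W i)))); congr ucorr.
  by apply/funext => i; rewrite lnN_stationary_REM.
apply/funext => i; rewrite exit_rate_REM lnM ?posrE ?expR_gt0//.
by rewrite expRK.
Qed.

Lemma rho_REM_bounds lam W : -1 <= rho G (REM G lam W) <= 1.
Proof. by rewrite rho_REM; apply: corr_le1; exact: ucov_cauchy. Qed.

Lemma rho_REM_deficit lam W : 0 < lam -> 0 < ucov W W ->
  1 - rho G (REM G lam W) <=
  2 / lam ^+ 2 * (ucov (nlse (- (1 - lam)) W) (nlse (- (1 - lam)) W) / ucov W W).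
Proof.
move=> l0 W0; rewrite rho_REM; set L := nlse _ _.
have := corr_deficit W0 (ucov_ge0 _) (ucov_cauchy W (fun i => lam * W i + L i)) l0.
rewrite -ucov_shift_scale.
have -> : (fun i => lam * W i + L i - lam * W i) = L.
  by apply/funext => i; rewrite addrAC subrr add0r.
move=> h; apply: (le_trans h); rewrite le_eqVlt; apply/orP; left; apply/eqP.
by field; rewrite !gt_eqF.
Qed.

(** Every [W j] is within [Num.sqrt V] of the mean [m], where [V] is [n] times the variance. All
    neighbourhoods having [d] elements, every log-sum-exp is within [|tau| * Num.sqrt V] of the
    common value [ln d + tau * m]. *)
Lemma ucov_nlse_le tau W : graph_regular G ->
  ucov (nlse tau W) (nlse tau W) <= n%:R * tau ^+ 2 * ucov W W.
Proof.
move=> [d Gd]; have nR : 0 < n%:R :> R by rewrite ltr0n.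
set m := umean W; set V := \sum_i (W i - m) ^+ 2.
have V0 : 0 <= V by apply: sumr_ge0 => i _; exact: sqr_ge0.
pose M := Num.sqrt V.
have WM j : `|tau * (W j - m)| <= `|tau| * M.
  rewrite normrM ler_wpM2l// -sqrtr_sqr ler_wsqrtr// /V (bigD1 j)//= lerDl.
  by apply: sumr_ge0 => i _; exact: sqr_ge0.
have dE i : \sum_(j | G i j) (1 : R) = d%:R.
  by rewrite sumr_const -(Gd i) cardsE.
have d0 : 0 < d%:R :> R.
  rewrite -(dE (Ordinal n_gt0)).
  have := sum_gt0 0 W (Ordinal n_gt0).
  by under eq_bigr do rewrite mul0r expR0.
pose c := ln d%:R + tau * m.
have bound i : (nlse tau W i - c) ^+ 2 <= tau ^+ 2 * V.
  have -> : tau ^+ 2 * V = (`|tau| * M) ^+ 2.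
    by rewrite exprMn real_normK ?num_real// sqr_sqrtr.
  rewrite -real_normK ?num_real// ler_sqr ?nnegrE ?mulr_ge0 ?sqrtr_ge0//.
  have S0 := sum_gt0 tau W i.
  have ec x : expR (c + x) = d%:R * expR (tau * m + x).
    by rewrite /c -addrA expRD lnK// posrE.
  rewrite ler_norml; apply/andP; split.
    rewrite lerBrDl -ler_expR lnK ?posrE// ec -(dE i) mulr_suml.
    apply: ler_sum => j _; rewrite mul1r ler_expR.
    by have := WM j; rewrite ler_norml => /andP[]; lra.
  rewrite lerBlDl -ler_expR lnK ?posrE// ec -(dE i) mulr_suml.
  apply: ler_sum => j _; rewrite mul1r ler_expR.
  by have := WM j; rewrite ler_norml => /andP[]; lra.
apply: (le_trans (ucov_le_center n_gt0 _ c)).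
rewrite ucov_sqr -/m -/V ler_pdivrMr//.
apply: (@le_trans _ _ (\sum_(i < n) tau ^+ 2 * V)).
  by apply: ler_sum => i _; exact: bound.
rewrite sumr_const card_ord -mulr_natl le_eqVlt; apply/orP; left; apply/eqP.
by field; rewrite gt_eqF.
Qed.

(* Dominates the indicator of [Var W < 4/5 s^2]: that event forces the mean of
   [W^2] below [9/10 s^2] or the absolute mean of [W] above [3/10 s]; each
   exponential is the Chernoff bound for one of the three half-lines. *)
Definition tail s W : R :=
  expR (36^-1 * (9 / 10 * n%:R - (\sum_i W i ^+ 2) / s ^+ 2)) +
  (expR (3 / 10 * ((\sum_i W i) / s - 3 / 10 * n%:R)) +
   expR (3 / 10 * (- (\sum_i W i) / s - 3 / 10 * n%:R))).

Lemma tail_ge0 s W : 0 <= tail s W.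
Proof. by rewrite !addr_ge0 ?expR_ge0. Qed.

Lemma tail_ge1 s W : 0 < s -> ucov W W < 4 / 5 * s ^+ 2 -> 1 <= tail s W.
Proof.
move=> s0; have nR : 0 < n%:R :> R by rewrite ltr0n.
rewrite (ucov_moments n_gt0) => h.
have e1 x : 0 <= x -> 1 <= expR x :> R by move=> x0; rewrite -expR0 ler_expR.
have [E1 E2] := (expR_ge0 (3 / 10 * ((\sum_i W i) / s - 3 / 10 * n%:R) : R),
  expR_ge0 (3 / 10 * (- (\sum_i W i) / s - 3 / 10 * n%:R) : R)).
have E3 := expR_ge0 (36^-1 * (9 / 10 * n%:R - (\sum_i W i ^+ 2) / s ^+ 2) : R).
have s2 : 0 < s ^+ 2 by rewrite exprn_gt0.
have [h1|h1] := leP ((\sum_i W i ^+ 2) / s ^+ 2) (9 / 10 * n%:R).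
  have := e1 (36^-1 * (9 / 10 * n%:R - (\sum_i W i ^+ 2) / s ^+ 2)).
  rewrite /tail mulr_ge0 ?subr_ge0// => /(_ isT); lra.
(* The mean square exceeds [9/10 s^2] and the variance is below [4/5 s^2], so the squared mean
   exceeds [1/10 s^2]. *)
have m2 : 9 / 100 * s ^+ 2 < umean W ^+ 2.
  move: h1; rewrite ltr_pdivlMr// => h1.
  have : 9 / 10 * s ^+ 2 < (\sum_i W i ^+ 2) / n%:R.
    by rewrite ltr_pdivlMr//; lra.
  lra.
set u := (\sum_i W i) / s.
have uE : umean W ^+ 2 = (u / n%:R) ^+ 2 * s ^+ 2.
  by rewrite /umean /u; field; rewrite !gt_eqF.
have {m2} u2 : (3 / 10) ^+ 2 < (u / n%:R) ^+ 2.
  by move: m2; rewrite uE ltr_pM2r//; lra.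
have : 3 / 10 < `|u / n%:R|.
  by rewrite -(@ltr_pXn2r _ 2) ?nnegrE// real_normK ?num_real.
rewrite lter_normr => /orP[h3|h3].
  have h4 : 3 / 10 * n%:R < u by rewrite -ltr_pdivlMr.
  have := e1 (3 / 10 * (u - 3 / 10 * n%:R)).
  rewrite mulr_ge0 ?subr_ge0 ?(ltW h4)// => /(_ isT).
  rewrite /tail -/u; lra.
have h4 : 3 / 10 * n%:R < - u by rewrite -ltr_pdivlMr// mulNr.
have := e1 (3 / 10 * (- u - 3 / 10 * n%:R)).
rewrite mulr_ge0 ?subr_ge0 ?(ltW h4)// => /(_ isT).
by rewrite /tail mulNr -/u; move: E1; rewrite -/u; lra.
Qed.

(** Either [ucov W W] is at least [4/5 s^2], or the ratio of variances is at most
    [n * (1 - lam) ^+ 2] while [tail] is at least 1. Both bounds are nonnegative, so their sum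
    covers both cases without an indicator. *)
Lemma rho_REM_deficit_tail lam s W : graph_regular G -> 0 < lam -> 0 < s ->
  0 < ucov W W ->
  1 - rho G (REM G lam W) <= 2 / lam ^+ 2 *
    (ucov (nlse (- (1 - lam)) W) (nlse (- (1 - lam)) W) / (4 / 5 * s ^+ 2)
     + n%:R * (1 - lam) ^+ 2 * tail s W).
Proof.
move=> Gr l0 s0 W0; apply: (le_trans (rho_REM_deficit l0 W0)).
set L := nlse _ _.
rewrite ler_wpM2l ?divr_ge0 ?sqr_ge0//.
have L0 : 0 <= ucov L L by exact: ucov_ge0.
have s2 : 0 < 4 / 5 * s ^+ 2 by rewrite mulr_gt0// exprn_gt0.
have n2 : 0 <= n%:R * (1 - lam) ^+ 2 by rewrite mulr_ge0 ?sqr_ge0.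
have [h|h] := leP (4 / 5 * s ^+ 2) (ucov W W).
  rewrite -[leLHS]addr0; apply: lerD; first by rewrite ler_wpM2l// lef_pV2.
  by apply: mulr_ge0 => //; exact: tail_ge0.
rewrite -[leLHS]add0r; apply: lerD; first by rewrite divr_ge0// ltW.
rewrite ler_pdivrMr//; apply: (le_trans (ucov_nlse_le _ W Gr)).
rewrite sqrrN ler_wpM2r ?(ltW W0)// ler_peMr//.
exact: tail_ge1.
Qed.

End neighbourhood_lse.

Section expectations.
Context {R : realType} {n : nat} (G : rel 'I_n) (s : R) (s0 : 0 < s).
Local Notation RN := (nat -> R).
Local Notation restr w := (fun i : 'I_n => w (nat_of_ord i)).
Implicit Types (x y : 'I_n -> RN -> R) (w : RN) (tau : R).

Lemma plot_ucov x y : (forall i, plot_measurable (x i)) ->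
  (forall i, plot_measurable (y i)) ->
  plot_measurable (fun w => ucov (fun i => x i w) (fun i => y i w)).
Proof.
move=> mx my.
have mm (z : 'I_n -> RN -> R) : (forall i, plot_measurable (z i)) ->
    plot_measurable (fun w : RN => umean (fun i : 'I_n => z i w)).
  by move=> mz; rewrite /umean; apply: plotM; [exact: plot_sum|exact: plot_cst].
rewrite /ucov; apply: plotM; last exact: plot_cst.
apply: plot_sum => i.
by apply: plotM; apply: plotD => //; apply: plotN; exact: mm.
Qed.

Lemma plot_ucorr x y : (forall i, plot_measurable (x i)) ->
  (forall i, plot_measurable (y i)) ->
  plot_measurable (fun w => ucorr (fun i => x i w) (fun i => y i w)).
Proof.
move=> mx my; rewrite /ucorr; apply: plotM; first exact: plot_ucov.
apply: plotV; apply: plot_sqrt; apply: plotM; exact: plot_ucov.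
Qed.

Lemma plot_nlse tau i : plot_measurable (fun w => nlse G tau (restr w) i).
Proof.
rewrite /nlse; apply: plot_ln; apply: plot_sum => j; apply: plot_expR.
by apply: plotM; [exact: plot_cst|exact: plot_coord].
Qed.

Local Notation N i := [set j | G i j].

(** The coordinates of the iterated integral are natural numbers; this carries vertex sets over to
    lists of them. *)
Definition ord_seq (A : {set 'I_n}) : seq nat := map (@nat_of_ord n) (enum A).

Let sum_ord_seq (A : {set 'I_n}) (F : nat -> R) : \sum_(j <- ord_seq A) F j = \sum_(j in A) F j.
Proof. by rewrite /ord_seq big_map big_enum. Qed.

Let mem_ord_seq (A : {set 'I_n}) j : (nat_of_ord j \in ord_seq A) = (j \in A).
Proof. by rewrite mem_map ?mem_enum//; exact: ord_inj. Qed.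

Let uniq_ord_seq (A : {set 'I_n}) : uniq (ord_seq A).
Proof. by rewrite map_inj_uniq ?enum_uniq//; exact: ord_inj. Qed.

Let ord_seq_sub (A : {set 'I_n}) : {subset ord_seq A <= iota 0 n}.
Proof. by move=> k /mapP[j _ ->]; rewrite mem_iota/=. Qed.

Let disjoint_ord_seq (A B : {set 'I_n}) : [disjoint A & B] -> ~~ has [in ord_seq A] (ord_seq B).
Proof.
move=> dAB; apply/hasPn => k /mapP[j jB ->]; rewrite /= mem_ord_seq.
by rewrite (disjointFl dAB)//; rewrite mem_enum in jB.
Qed.

Lemma giter_nlse_diff_sqr d tau i k w : (0 < d)%N -> (forall i, #|N i| = d) ->
  (giter s (iota 0 n)
     (fun w => ((nlse G tau (restr w) i - nlse G tau (restr w) k) ^+ 2)%:E) w <=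
   (tau ^+ 2 * s ^+ 2 * (1281 / 250))%:E)%E.
Proof.
move=> d0 Gd.
pose C := N i :&: N k; pose A := N i :\: N k; pose B := N k :\: N i.
pose ps := zip (ord_seq A) (ord_seq B).
(* Equal degrees make the two set differences equinumerous, so [zip] drops nothing. *)
have sAB : size (ord_seq A) = size (ord_seq B).
  rewrite !size_map -!cardE; apply/eqP.
  rewrite -(eqn_add2l #|C|) {1}/C cardsID /C finset.setIC cardsID.
  by rewrite !Gd.
have e1 : unzip1 ps = ord_seq A by rewrite unzip1_zip// sAB.
have e2 : unzip2 ps = ord_seq B by rewrite unzip2_zip// sAB.
have lseE j (M : {set 'I_n}) w' : nlse G tau (restr w') j =
    lse tau (ord_seq (N j :&: M) ++ ord_seq (N j :\: M)) w'.
  congr ln; rewrite /sumexp big_cat/= !sum_ord_seq -big_setID.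
  by apply: eq_bigl => j'; rewrite inE.
have dCA : [disjoint C & A].
  by rewrite -finset.setI_eq0; apply/eqP/finset.setP => j; rewrite !inE; do 2 case: (G _ _).
have dCB : [disjoint C & B].
  by rewrite -finset.setI_eq0; apply/eqP/finset.setP => j; rewrite !inE; do 2 case: (G _ _).
have dAB : [disjoint A & B].
  by rewrite -finset.setI_eq0; apply/eqP/finset.setP => j; rewrite !inE; do 2 case: (G _ _).
have uS : uniq (ord_seq C ++ (unzip1 ps ++ unzip2 ps)).
  rewrite e1 e2 !cat_uniq !uniq_ord_seq has_cat negb_or !disjoint_ord_seq//.
have sub : {subset unzip1 ps ++ unzip2 ps <= iota 0 n}.
  by move=> j; rewrite e1 e2 mem_cat => /orP[]; exact: ord_seq_sub.
have sz : (0 < size (ord_seq C ++ unzip1 ps))%N.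
  by rewrite e1 size_cat !size_map -!cardE cardsID Gd.
have := giter_lse_diff_sqr s0 tau uS (iota_uniq _ _) sub sz w.
rewrite e1 e2.
set g1 := (X in (giter _ _ X _ <= _)%E -> _).
set g2 := (X in _ -> (giter _ _ X _ <= _)%E).
have -> // : g1 = g2.
by apply/funext => v; rewrite /g1 /g2 (lseE i (N k)) (lseE k (N i)) [N k :&: _]finset.setIC.
Qed.

(** The variance is half the average of the squared differences over ordered pairs, so the pairwise
    constant [1281 / 250] is halved. *)
Lemma giter_ucov_nlse tau w : (1 < n)%N -> graph_connected G -> graph_regular G ->
  (giter s (iota 0 n)
     (fun w => (ucov (nlse G tau (restr w)) (nlse G tau (restr w)))%:E) w <=
   (tau ^+ 2 * s ^+ 2 * (1281 / 500))%:E)%E.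
Proof.
move=> n1 Gc [d Gd]; have n0 : (0 < n)%N by exact: ltnW.
have nR : 0 < n%:R :> R by rewrite ltr0n.
have d0 : (0 < d)%N.
  have [j Gj] := connected_neighbour n1 Gc (Ordinal n0).
  rewrite -(Gd (Ordinal n0)); apply/card_gt0P; exists j; by rewrite inE.
pose F (p : 'I_n * 'I_n) w :=
  (nlse G tau (restr w) p.1 - nlse G tau (restr w) p.2) ^+ 2.
have mF p : plot_measurable (F p).
  by apply: plotX; apply: plotD; [|apply: plotN]; exact: plot_nlse.
have F0 p v : 0 <= F p v by exact: sqr_ge0.
pose c : R := (2 * n%:R ^+ 2)^-1.
have c0 : 0 <= c by rewrite invr_ge0 mulr_ge0// sqr_ge0.
rewrite (_ : (fun _ => _) = fun v => (c%:E * (\sum_(p : 'I_n * 'I_n) F p v)%:E)%E);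
  last first.
  apply/funext => v; rewrite (ucov_pairs n0) -EFinM; congr EFin; rewrite mulrC.
  by congr (_ * _); rewrite pair_bigA.
rewrite giterZ//; last first.
  apply: ge0_plot_EFin; first exact: plot_sum.
  by move=> v; apply: sumr_ge0.
rewrite giter_sum//.
apply: (@le_trans _ _ (c%:E * \sum_(p : 'I_n * 'I_n)
   (tau ^+ 2 * s ^+ 2 * (1281 / 250))%:E)%E).
  rewrite lee_wpmul2l ?lee_fin//; apply: lee_sum => p _.
  exact: (giter_nlse_diff_sqr _ _ _ _ d0 Gd).
rewrite sumEFin -EFinM lee_fin sumr_const card_prod card_ord -[_ *+ (n * n)%N]mulr_natr natrM.
rewrite le_eqVlt; apply/orP; left; apply/eqP.
by rewrite /c; field; rewrite gt_eqF.
Qed.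

Lemma plot_tail : plot_measurable (fun w => tail s (restr w)).
Proof.
rewrite /tail; apply: plotD; last apply: plotD; apply: plot_expR; (apply: plotM; [exact: plot_cst|]);
  apply: plotD; try exact: plot_cst.
- apply: plotN; apply: plotM; last exact: plot_cst.
  by apply: plot_sum => i; apply: plotX; exact: plot_coord.
- apply: plotM; last exact: plot_cst.
  by apply: plot_sum => i; exact: plot_coord.
- apply: plotM; last exact: plot_cst.
  by apply: plotN; apply: plot_sum => i; exact: plot_coord.
Qed.

(** The larger of the expectations per coordinate in the Chernoff bounds. The first is
    [expR (9/10 * 1/36)] times the mean of [expR (- x^2 / (36 s^2))]; the second is
    [expR (- 9/100 + (3/10)^2 / 2)]. *)
Definition tail_rate : R :=
  Num.max (expR 40^-1 / Num.sqrt (1 + 18^-1)) (expR (- (9 / 200))).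

Lemma tail_rate_gt0 : 0 < tail_rate.
Proof. by rewrite lt_max expR_gt0 orbT. Qed.

Lemma tail_rate_lt1 : tail_rate < 1.
Proof.
have h0 : 0 < Num.sqrt (1 + 18^-1 : R) by rewrite sqrtr_gt0; lra.
rewrite gt_max; apply/andP; split; last by rewrite -[ltRHS]expR0 ltr_expR; lra.
(* After squaring, the claim is [expR (1/20) < 19/18]; it holds since [expR (- 1/20) >= 19/20] and
   [20/19 < 19/18]. *)
rewrite ltr_pdivrMr// mul1r -(@ltr_pXn2r _ 2) ?nnegrE ?expR_ge0 ?sqrtr_ge0//.
rewrite sqr_sqrtr; last by lra.
rewrite -expRM_natl.
have : expR (- (2 * 40^-1)) >= 1 - 20^-1 :> R.
  by apply: le_trans (expR_ge1Dx _); lra.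
rewrite expRN => h; have e0 := expR_gt0 (2 * 40^-1 : R).
have : expR (2 * 40^-1) * (1 - 20^-1) <= 1 :> R.
  by rewrite -ler_pdivlMl// mulr1.
lra.
Qed.

(** Each of the three exponentials is a product over the coordinates, so its expectation is an
    [n]-th power. *)
Lemma giter_tail w : (giter s (iota 0 n) (fun w => (tail s (restr w))%:E) w <=
  (3 * tail_rate ^+ n)%:E)%E.
Proof.
have sn0 : s != 0 by rewrite gt_eqF.
pose f1 (x : R) := expR 40^-1 * expR (- (36^-1 * (x ^+ 2 / s ^+ 2))).
pose f2 (c : R) (x : R) := expR (- (9 / 100)) * expR (c / s * x).
have m1 : measurable_fun [set: R] f1.
  apply: measurable_funM => //; apply: measurable_fun_expR; apply: measurable_funN.
  apply: measurable_funM => //; apply: measurable_funM => //; exact: measurable_funX.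
have m2 c : measurable_fun [set: R] (f2 c).
  by apply: measurable_funM => //; apply: measurable_fun_expR; exact: measurable_funM.
have p1 (a : R) : 0 <= f1 a by rewrite mulr_ge0 ?expR_ge0.
have p2 c (a : R) : 0 <= f2 c a by rewrite mulr_ge0 ?expR_ge0.
pose k1 : R := expR 40^-1 / Num.sqrt (1 + 18^-1).
pose k2 : R := expR (- (9 / 200)).
have k10 : 0 <= k1 by rewrite divr_ge0 ?expR_ge0 ?sqrtr_ge0.
have k20 : 0 <= k2 by exact: expR_ge0.
have i1 : (\int[normal_prob 0 s]_x (f1 x)%:E = k1%:E)%E.
  under eq_integral => x _ do rewrite EFinM.
  rewrite ge0_integralZl//=.
  - rewrite normal_expN_sqr//.
    by rewrite -EFinM; congr (_ / Num.sqrt (1 + _))%:E; field.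
  - apply/measurable_EFinP; apply: measurable_fun_expR; apply: measurable_funN.
    apply: measurable_funM => //; apply: measurable_funM => //; exact: measurable_funX.
have i2 c : c ^+ 2 = (3 / 10) ^+ 2 -> (\int[normal_prob 0 s]_x (f2 c x)%:E = k2%:E)%E.
  move=> c2; under eq_integral => x _ do rewrite EFinM.
  rewrite ge0_integralZl//=.
  - rewrite normal_mgf// -EFinM -expRD; congr (expR _)%:E.
    by rewrite -exprMn divfK// c2; field.
  - by apply/measurable_EFinP; apply: measurable_fun_expR; exact: measurable_funM.
have prodE c (h : R -> R) (v : RN) : \prod_(i < n) (expR c * expR (h (v i))) =
    expR (c * n%:R + \sum_(i < n) h (v i)).
  rewrite big_split/= prodr_const card_ord -expRM_natr expRD; congr (_ * _).
  by rewrite expR_sum.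
have pP (f : R -> R) : measurable_fun [set: R] f -> (forall a : R, 0 <= f a) ->
    ge0_plot (fun v : RN => (\prod_(i < n) f (v i))%:E).
  move=> mf f0; apply: ge0_plot_EFin => [d X phi mphi|v]; last exact: prodr_ge0.
  apply: measurable_prod => i _; exact: (measurableT_comp mf (mphi i)).
rewrite (_ : (fun _ => _) = fun v : RN => ((\prod_(i < n) f1 (v i))%:E +
   ((\prod_(i < n) f2 (3 / 10) (v i))%:E + (\prod_(i < n) f2 (- (3 / 10)) (v i))%:E))%E);
  last first.
  apply/funext => v; rewrite -!EFinD; congr EFin; rewrite /tail.
  rewrite (prodE _ (fun a => - (36^-1 * (a ^+ 2 / s ^+ 2)))).
  rewrite (prodE _ (fun a => 3 / 10 / s * a)) (prodE _ (fun a => - (3 / 10) / s * a)).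
  congr (expR _ + (expR _ + expR _)).
  - by rewrite sumrN -mulr_sumr -mulr_suml; field.
  - by rewrite -mulr_sumr; field.
  - by rewrite -mulr_sumr; field.
have P1 := pP _ m1 p1; have P2 c := pP _ (m2 c) (p2 c).
rewrite giterD//; last exact: ge0_plotD.
rewrite giterD// (giter_prod n w m1 p1 k10 i1).
rewrite (giter_prod n w (m2 _) (p2 _) k20 (i2 (3 / 10) erefl)).
rewrite (giter_prod n w (m2 _) (p2 _) k20 (i2 (- (3 / 10)) (sqrrN _))).
rewrite -!EFinD lee_fin.
have k1r : k1 ^+ n <= tail_rate ^+ n.
  by rewrite lerXn2r ?nnegrE ?(ltW tail_rate_gt0)// le_max lexx.
have k2r : k2 ^+ n <= tail_rate ^+ n.
  by rewrite lerXn2r ?nnegrE ?(ltW tail_rate_gt0)// le_max lexx orbT.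
lra.
Qed.

End expectations.

(** * The expectation of [1 - rho] *)

Section expected_deficit.
Context {R : realType} {n : nat} (G : rel 'I_n) (s lam : R).
Hypotheses (n_gt1 : (1 < n)%N) (G_simple : simple_graph G).
Hypotheses (G_conn : graph_connected G) (G_reg : graph_regular G).
Hypothesis (s0 : 0 < s).
Local Notation RN := (nat -> R).
Local Notation restr w := (fun i : 'I_n => w (nat_of_ord i)).
Local Notation rhoW w := (rho G (REM G lam (restr w))).

Lemma plot_rho : plot_measurable (fun w : RN => rhoW w).
Proof.
rewrite (_ : (fun _ => _) = fun w : RN => ucorr (restr w)
  (fun i => lam * w i + nlse G (- (1 - lam)) (restr w) i)); last first.
  by apply/funext => w; rewrite rho_REM.
apply: (@plot_ucorr R n (fun i w => w i)
  (fun i w => lam * w i + nlse G (- (1 - lam)) (restr w) i)) => i.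
  exact: plot_coord.
apply: plotD; last exact: plot_nlse.
by apply: plotM; [exact: plot_cst|exact: plot_coord].
Qed.

Lemma expected_deficit_le2 w :
  (giter s (iota 0 n) (fun w => (1 - rhoW w)%:E) w <= 2%:E)%E.
Proof.
apply: (@le_trans _ _ (giter s (iota 0 n) (fun=> 2%:E) w)); last by rewrite giter_cst.
have b v := rho_REM_bounds G_simple G_conn n_gt1 lam (restr v).
apply: giter_le => [||v].
- apply: ge0_plot_EFin => [|v]; last by have /andP[] := b v; lra.
  by apply: plotD; [exact: plot_cst|apply: plotN; exact: plot_rho].
- by apply: ge0_plot_EFin => [|_]; [exact: plot_cst|].
- by rewrite lee_fin; have /andP[] := b v; lra.
Qed.

(** The constant [1281 / 400] is [1281 / 500], from the variance of the log-sum-exp, divided by the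
    threshold [4 / 5]; the last term is the contribution of [tail]. *)
Lemma expected_deficit w : 0 < lam ->
  (giter s (iota 0 n) (fun w => (1 - rhoW w)%:E) w <=
   (2 / lam ^+ 2 * (1 - lam) ^+ 2 *
     (1281 / 400 + 3 * (n%:R * tail_rate ^+ n)))%:E)%E.
Proof.
move=> l0; have n_gt0 : (0 < n)%N by exact: ltnW.
pose tau := - (1 - lam).
pose U (v : RN) := ucov (nlse G tau (restr v)) (nlse G tau (restr v)).
(* Takes care of the null event [Var W = 0], where [rho] has the junk value 0. *)
pose null (v : RN) : R := \1_([set 0 : R]%classic) (v 0%N - v 1%N).
pose K := 2 / lam ^+ 2.
have K0 : 0 <= K by rewrite divr_ge0 ?sqr_ge0.
pose c1 := K / (4 / 5 * s ^+ 2).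
pose c2 := K * (n%:R * (1 - lam) ^+ 2).
have s2 : 0 < s ^+ 2 by rewrite exprn_gt0.
have c10 : 0 <= c1 by rewrite divr_ge0// mulr_ge0// ltW.
have c20 : 0 <= c2 by rewrite mulr_ge0// mulr_ge0// sqr_ge0.
have null0 v : 0 <= null v by rewrite /null indicE ler0n.
have b v := rho_REM_bounds G_simple G_conn n_gt1 lam (restr v).
have pU : ge0_plot (fun v => (U v)%:E).
  apply: ge0_plot_EFin => [|v]; last exact: ucov_ge0.
  apply: (@plot_ucov R n (fun i v => nlse G tau (restr v) i)
    (fun i v => nlse G tau (restr v) i)) => i; exact: plot_nlse.
have pT : ge0_plot (fun v : RN => (tail s (restr v))%:E).
  by apply: ge0_plot_EFin => [|v]; [exact: plot_tail|exact: tail_ge0].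
have pN : ge0_plot (fun v => (null v)%:E).
  apply: ge0_plot_EFin => // d X phi mphi.
  have mi : measurable_fun setT (\1_([set 0 : R]%classic) : R -> R).
    exact: measurable_indic.
  by apply: (measurableT_comp mi); apply: measurable_funB; exact: mphi.
have pZ (c : R) g : 0 <= c -> ge0_plot g -> ge0_plot (fun v : RN => c%:E * g v)%E.
  move=> c0 [mg g0]; split=> [d X phi mphi|v]; last by rewrite mule_ge0.
  by apply: emeasurable_funM => //; exact: mg.
have pg : ge0_plot (fun v : RN => (1 - rhoW v)%:E).
  apply: ge0_plot_EFin => [|v]; last by have /andP[] := b v; lra.
  by apply: plotD; [exact: plot_cst|apply: plotN; exact: plot_rho].
pose h v := (c1%:E * (U v)%:E + (c2%:E * (tail s (restr v))%:E + 2%:E * (null v)%:E))%E.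
have p23 := ge0_plotD (pZ _ _ c20 pT) (pZ 2 _ (ler0n _ _) pN).
have ph := ge0_plotD (pZ _ _ c10 pU) p23.
apply: (@le_trans _ _ (giter s (iota 0 n) h w)).
  apply: giter_le => // v; rewrite /h -!EFinM -!EFinD lee_fin.
  have T0 := tail_ge0 s (restr v); have U0 : 0 <= U v by exact: ucov_ge0.
  have := ucov_ge0 (restr v); rewrite le_eqVlt => /predU1P[v0|v0].
    have -> : null v = 1.
      rewrite /null indicE; have := ucov_eq0 n_gt0 (esym v0) (Ordinal n_gt0) (Ordinal n_gt1).
      by move=> /= ->; rewrite subrr mem_set.
    have := mulr_ge0 c10 U0; have := mulr_ge0 c20 T0.
    by have /andP[] := b v; lra.
  have := rho_REM_deficit_tail G_simple G_conn n_gt1 G_reg l0 s0 v0.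
  rewrite -/K -/tau -/(U v) => /le_trans; apply.
  rewrite (_ : K * _ = c1 * U v + c2 * tail s (restr v)); last by rewrite /c1 /c2; ring.
  by have := null0 v; lra.
rewrite giterD//; [|exact: pZ].
rewrite giterD//; [|exact: pZ|exact: pZ].
rewrite !giterZ//.
have -> : giter s (iota 0 n) (fun v => (null v)%:E) w = 0%E.
  by apply: giter_coord_eq => //; rewrite mem_iota.
rewrite mule0 adde0.
have hU := giter_ucov_nlse s0 tau w n_gt1 G_conn G_reg.
have hT := giter_tail (n := n) s0 w.
apply: (le_trans (leeD (lee_wpmul2l _ hU) (lee_wpmul2l _ hT))).
- by rewrite lee_fin.
- by rewrite lee_fin.
rewrite -!EFinM -EFinD lee_fin le_eqVlt; apply/orP; left; apply/eqP.
by rewrite /c1 /c2 /K /tau; field; rewrite !gt_eqF.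
Qed.

End expected_deficit.

Unset Implicit Arguments.

Theorem theorem2 (R : realType) :
  exists C : R, forall (n : nat) (G : rel 'I_n) (sW lam : R),
    (6 <= n)%N -> simple_graph G -> graph_connected G -> graph_regular G ->
    0 < sW -> 0 <= lam <= 1 ->
    ((1 - 16 * (1 + C / Num.sqrt n%:R) * (1 - lam) ^+ 2)%:E
       <= gauss_expect sW (fun W => rho G (REM G lam W)))%E.
Proof.
have [D D0 HD] := geometric_decay (@tail_rate_gt0 R) (@tail_rate_lt1 R).
(* The 3 counts the exponentials in [tail]; their coefficient [4.88 * 3] stays below [16 * 3]. *)
exists (3 * D) => n G s lam n6 Gs Gc Gr s0 /andP[l0 l1].
have n1 : (1 < n)%N by apply: leq_trans n6.
have n0 : (0 < n)%N by exact: ltnW.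
have nR : 0 < Num.sqrt n%:R :> R by rewrite sqrtr_gt0 ltr0n.
have DD : 0 <= D / Num.sqrt n%:R by rewrite divr_ge0// ltW.
rewrite /gauss_expect gauss_iterE giter_one_minus; last 2 first.
- exact: plot_rho.
- by move=> w; exact: rho_REM_bounds.
rewrite EFinB leeB// [3 * D / _](_ : _ = 3 * (D / Num.sqrt n%:R)); last by ring.
set e := D / Num.sqrt n%:R in DD *.
have [eps|eps] := leP (1 / 8) ((1 - lam) ^+ 2).
  apply: (le_trans (expected_deficit_le2 _ _ _ _ _ _)) => //.
  rewrite lee_fin; nra.
(* [1 - lam] is below the square root of [1/8], which is less than 0.354; and [0.646^2 > 0.41]
   yields [2 / lam ^+ 2 <= 4.88]. *)
have lam0 : 646 / 1000 < lam by nra.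
have lam2 : 41 / 100 <= lam ^+ 2 by nra.
have lamp : 0 < lam by lra.
apply: (le_trans (expected_deficit _ _ _ _ _ _ _)) => //.
have eps0 : 0 <= (1 - lam) ^+ 2 by exact: sqr_ge0.
rewrite lee_fin mulrAC ler_wpM2r//.
have h := HD n n0; rewrite -/e in h.
have K : 2 / lam ^+ 2 <= 488 / 100.
  by rewrite ler_pdivrMr ?exprn_gt0//; lra.
have K0 : 0 <= 2 / lam ^+ 2 by rewrite divr_ge0 ?sqr_ge0.
(* [4.88 * 1281 / 400] is about 15.63, just below 16. *)
apply: (@le_trans _ _ (488 / 100 * (1281 / 400 + 3 * e))); last by lra.
have h0 : 0 <= n%:R * tail_rate ^+ n :> R.
  by apply: mulr_ge0; [exact: ler0n|apply: exprn_ge0; exact/ltW/tail_rate_gt0].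
by apply: ler_pM; [exact: K0|lra|exact: K|lra].
Qed.
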